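(* Let $\mathcal{A}$ be a commutative unital $C^*$-algebra and $\mathcal{H}$ a complex separable Hilbert space. Then the $C^*$-convex hull of the collection of all unital $*$-homomorphisms $\mathcal{A}\to\mathcal{B}(\mathcal{H})$ is dense in $UCP_{\mathcal{H}}(\mathcal{A})$ with respect to the bounded-weak topology. In particular, the $C^*$-convex hull of the collection of all $C^*$-extreme points of $UCP_{\mathcal{H}}(\mathcal{A})$ is dense in $UCP_{\mathcal{H}}(\mathcal{A})$ with respect to the bounded-weak topology.
   Context: $\mathcal{B}(\mathcal{H})$ denotes the bounded operators on $\mathcal{H}$, and $UCP_{\mathcal{H}}(\mathcal{A})$ is the set of all unital completely positive linear maps $\mathcal{A}\to\mathcal{B}(\mathcal{H})$. The bounded-weak topology on $UCP_{\mathcal{H}}(\mathcal{A})$ is given by: a net $\phi_i$ converges to $\phi$ if and only if $\phi_i(a)\to\phi(a)$ in the weak operator topology for every $a\in\mathcal{A}$. The $C^*$-convex hull of $\mathcal{N}\subseteq UCP_{\mathcal{H}}(\mathcal{A})$ is the set of all $\sum_{i=1}^n T_i^*\phi_i(\cdot)T_i$ with $n\ge1$, $\phi_i\in\mathcal{N}$, $T_i\in\mathcal{B}(\mathcal{H})$ and $\sum_{i=1}^n T_i^*T_i=I_{\mathcal{H}}$. A map $\phi\in UCP_{\mathcal{H}}(\mathcal{A})$ is a $C^*$-extreme point of $UCP_{\mathcal{H}}(\mathcal{A})$ if, whenever $\phi=\sum_{i=1}^n T_i^*\phi_i(\cdot)T_i$ with $\phi_i\in UCP_{\mathcal{H}}(\mathcal{A})$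 and invertible $T_i\in\mathcal{B}(\mathcal{H})$ satisfying $\sum_{i=1}^n T_i^*T_i=I_{\mathcal{H}}$, then for every $i$ there is a unitary $U_i\in\mathcal{B}(\mathcal{H})$ with $\phi=U_i^*\phi_i(\cdot)U_i$. *)

(* Defs.v *)
From HB Require Import structures.
From mathcomp Require Import all_boot all_order all_algebra.
From mathcomp Require Import sesquilinear complex.
From mathcomp Require Import all_classical all_reals all_analysis.

Set Implicit Arguments.
Unset Strict Implicit.
Unset Printing Implicit Defensive.

Import Order.TTheory GRing.Theory Num.Theory.
Import numFieldNormedType.Exports.

Local Open Scope classical_set_scope.
Local Open Scope ring_scope.

(* The inner product is linear in its first argument and conjugate linear in
   the second one. *)
HB.mixin Record CompleteNormedModule_isHilbert (R : realType) H
    of CompleteNormedModule R[i] H := {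
  inner : {dot H for (@Num.conj R[i])} ;
  sqr_norm_inner : forall x : H, `|x| ^+ 2 = inner x x
}.

#[short(type="hilbertType")]
HB.structure Definition Hilbert (R : realType) :=
  {H of CompleteNormedModule R[i] H & CompleteNormedModule_isHilbert R H}.

(* A unital C*-algebra, with 1 != 0 as for every algType. Algebras and normed
   modules have no common substructure in the hierarchy, so that the algebra
   structure is given here by explicit axioms and made canonical below. *)
HB.mixin Record CompleteNormedModule_isCStar (R : realType) A
    of CompleteNormedModule R[i] A := {
  cmul : A -> A -> A ;
  cone : A ;
  cmulA : associative cmul ;
  cmul1 : left_id cone cmul ;
  cmulr1 : right_id cone cmul ;
  cmulDl : left_distributive cmul +%R ;
  cmulDr : right_distributive cmul +%R ;
  cone_neq0 : cone != 0 ;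
  cscaleAl : forall (c : R[i]) a b, c *: cmul a b = cmul (c *: a) b ;
  cscaleAr : forall (c : R[i]) a b, c *: cmul a b = cmul a (c *: b) ;
  star : A -> A ;
  starK : involutive star ;
  starD : {morph star : a b / a + b} ;
  starZ : forall (c : R[i]) a, star (c *: a) = Num.conj c *: star a ;
  starM : forall a b, star (cmul a b) = cmul (star b) (star a) ;
  norm_cmul : forall a b, `|cmul a b| <= `|a| * `|b| ;
  norm_star_cmul : forall a, `|cmul (star a) a| = `|a| ^+ 2
}.

#[short(type="cstarType")]
HB.structure Definition CStarAlgebra (R : realType) :=
  {A of CompleteNormedModule R[i] A & CompleteNormedModule_isCStar R A}.

#[non_forgetful_inheritance]
HB.instance Definition _ (R : realType) (A : cstarType R) :=
  GRing.Zmodule_isNzRing.Build A (@cmulA R A) (@cmul1 R A) (@cmulr1 R A)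
    (@cmulDl R A) (@cmulDr R A) (@cone_neq0 R A).
#[non_forgetful_inheritance]
HB.instance Definition _ (R : realType) (A : cstarType R) :=
  GRing.Lmodule_isLalgebra.Build R[i] A (@cscaleAl R A).
#[non_forgetful_inheritance]
HB.instance Definition _ (R : realType) (A : cstarType R) :=
  GRing.Lalgebra_isAlgebra.Build R[i] A (@cscaleAr R A).

Section BoundedOperators.
Variables (R : realType) (H : hilbertType R).

Definition bounded_linear (f : H -> H) : Prop :=
  linear f /\ exists M : R[i], forall x, `|f x| <= M * `|x|.

Definition bounded_linear_pred : {pred H -> H} := fun f => `[< bounded_linear f >].

Record bounded_op := BoundedOp {
  bounded_op_fun :> H -> H ;
  _ : bounded_op_fun \in bounded_linear_pred
}.

HB.instance Definition _ := [isSub for bounded_op_fun].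
HB.instance Definition _ := [Choice of bounded_op by <:].

Lemma bounded_opP (T : bounded_op) : bounded_linear T.
Proof. exact/asboolP/(valP T). Qed.

HB.instance Definition _ (T : bounded_op) :=
  GRing.isLinear.Build R[i] H H *:%R T (bounded_opP T).1.

Lemma bounded_op_ext (S T : bounded_op) : S =1 T -> S = T.
Proof. by move=> ST; apply/val_inj/funext. Qed.

Lemma bounded_linear_submod : submod_closed bounded_linear_pred.
Proof.
split.
  apply/asboolP; split; first by move=> c x y; rewrite /= scaler0 addr0.
  by exists 0 => x; rewrite /= normr0 mul0r.
move=> c f g /asboolP[lf [M fM]] /asboolP[lg [N gN]]; apply/asboolP; split.
  move=> d x y; rewrite !fctE lf lg !scalerDr !scalerA (mulrC c d).
  by rewrite addrACA.
exists (`|c| * M + N) => x; rewrite !fctE (le_trans (ler_normD _ _))// normrZ.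
by rewrite mulrDl lerD// -mulrA ler_wpM2l.
Qed.

HB.instance Definition _ :=
  GRing.isSubmodClosed.Build R[i] (H -> H) bounded_linear_pred
    bounded_linear_submod.
HB.instance Definition _ :=
  [SubChoice_isSubLmodule of bounded_op by <:].

Lemma bounded_linear_id : (id : H -> H) \in bounded_linear_pred.
Proof. by apply/asboolP; split=> //; exists 1 => x; rewrite mul1r. Qed.

Lemma bounded_linear_comp (S T : bounded_op) :
  (S \o T : H -> H) \in bounded_linear_pred.
Proof.
have [_ [M SM]] := bounded_opP S; have [_ [N TN]] := bounded_opP T.
apply/asboolP; split; first by move=> c x y /=; rewrite !linearP.
exists (`|M| * N) => x /=; rewrite -mulrA.
apply: le_trans (ler_wpM2l (normr_ge0 _) (TN x)).
apply: le_trans (SM _) _.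
have [->|Tx0] := eqVneq (T x) 0; first by rewrite normr0 !mulr0.
have M0 : 0 <= M.
  have := le_trans (normr_ge0 _) (SM (T x)).
  by rewrite pmulr_lge0// normr_gt0.
by rewrite ger0_norm.
Qed.

Definition id_op := BoundedOp bounded_linear_id.
Definition comp_op S T := BoundedOp (bounded_linear_comp S T).

Lemma comp_opA : associative comp_op.
Proof. by move=> ? ? ?; exact: bounded_op_ext. Qed.

Lemma comp_1op : left_id id_op comp_op.
Proof. by move=> ?; exact: bounded_op_ext. Qed.

Lemma comp_op1 : right_id id_op comp_op.
Proof. by move=> ?; exact: bounded_op_ext. Qed.

Lemma comp_opDl : left_distributive comp_op +%R.
Proof. by move=> ? ? ?; exact: bounded_op_ext. Qed.

Lemma comp_opDr : right_distributive comp_op +%R.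
Proof. by move=> S ? ?; apply: bounded_op_ext => x; exact: linearD. Qed.

(* Not an algType: bounded_op is the zero ring when H is the zero space. *)
HB.instance Definition _ := GRing.Zmodule_isPzRing.Build bounded_op
  comp_opA comp_1op comp_op1 comp_opDl comp_opDr.

(* The adjoint exists by the Riesz representation theorem and is unique, so
   that the default value 0 is never used. *)
Definition adjoint (T : bounded_op) : bounded_op :=
  xget 0 [set S : bounded_op | forall x y, inner (T x) y = inner x (S y)].

Definition invertible_op (T : bounded_op) : Prop :=
  exists S : bounded_op, S * T = 1 /\ T * S = 1.

Definition unitary_op (U : bounded_op) : Prop :=
  adjoint U * U = 1 /\ U * adjoint U = 1.

(* bounded_op with the weak operator topology: the coarsest one for which
   T |-> <T x, y> is continuous for all x and y. *)
Definition wot : Type := initial_topology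
  (fun T : bounded_op =>
    (fun xy => inner (T xy.1) xy.2) : {ptws H * H -> R[i]^o}).

HB.instance Definition _ := Topological.on wot.

Definition separable_space : Prop := exists2 D : set H, countable D & dense D.

End BoundedOperators.

Section UnitalCompletelyPositive.
Variables (R : realType) (A : cstarType R) (H : hilbertType R).
Notation BH := (bounded_op H).

(* Positivity in the C*-algebra M_n(A). *)
Definition positive_mx n (X : 'M[A]_n) : Prop :=
  exists Y : 'M[A]_n, X = (map_mx star Y)^T *m Y.

(* Positivity in M_n(B(H)), identified with B(H^n). *)
Definition positive_op_mx n (X : 'M[BH]_n) : Prop :=
  forall x : 'I_n -> H, 0 <= \sum_i \sum_j inner (X i j (x j)) (x i).

Definition completely_positive (phi : A -> BH) : Prop :=
  forall n (X : 'M[A]_n), positive_mx X -> positive_op_mx (map_mx phi X).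

Definition ucp_map (phi : A -> BH) : Prop :=
  [/\ linear phi, phi 1 = 1 & completely_positive phi].

Definition unital_star_hom (phi : A -> BH) : Prop :=
  [/\ linear phi, phi 1 = 1, {morph phi : a b / a * b}
    & forall a, phi (star a) = adjoint (phi a)].

Definition cstar_convex_comb n (T : 'I_n -> BH) (psi : 'I_n -> A -> BH)
    (phi : A -> BH) : Prop :=
  \sum_(i < n) adjoint (T i) * T i = 1 /\
  forall a, phi a = \sum_(i < n) adjoint (T i) * psi i a * T i.

Definition cstar_convex_hull (N : set (A -> BH)) : set (A -> BH) :=
  [set phi | exists n (T : 'I_n -> BH) (psi : 'I_n -> A -> BH),
    [/\ (0 < n)%N, forall i, N (psi i) & cstar_convex_comb T psi phi]].

Definition cstar_extreme (phi : A -> BH) : Prop :=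
  ucp_map phi /\
  forall n (T : 'I_n -> BH) (psi : 'I_n -> A -> BH),
    (forall i, ucp_map (psi i)) -> (forall i, invertible_op (T i)) ->
    cstar_convex_comb T psi phi ->
    forall i, exists2 U, unitary_op U
      & forall a, phi a = adjoint U * psi i a * U.

(* Coerced to a type, this set carries the subspace topology of the topology of
   pointwise convergence in wot, that is, the bounded-weak topology. *)
Definition UCP : set {ptws A -> wot H} := ucp_map.

Definition bw_dense (N : set (A -> BH)) : Prop :=
  dense (set_val @^-1` N : set (set_type UCP)).

End UnitalCompletelyPositive.

(* Main.v *)
Require Import Defs.
From HB Require Import structures.
From mathcomp Require Import all_boot all_order all_algebra.
From mathcomp Require Import sesquilinear complex.
From mathcomp Require Import all_classical all_reals all_analysis.
From mathcomp Require Import ring lra.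

Set Implicit Arguments.
Unset Strict Implicit.
Unset Printing Implicit Defensive.

Import Order.TTheory GRing.Theory Num.Theory.
Import numFieldNormedType.Exports.

Local Open Scope classical_set_scope.
Local Open Scope ring_scope.

(** Write A as the functions on its space of characters. A unital completely
positive map phi is then integration against an operator-valued probability
measure, and such an integral is approximated by Riemann sums: choose a
partition of unity e_1, ..., e_m in A and characters chi_1, ..., chi_m such
that a given finite set of elements a varies little around chi_j(a) on e_j;
then phi(a) is close to the sum of the chi_j(a) phi(e_j). If phi(e_j) = T_j^2
with T_j self-adjoint, this sum is the C*-convex combination with coefficients
T_j of the homomorphisms a |-> chi_j(a) 1. These homomorphisms are also
C*-extreme, so both density statements follow from the same approximation.

The partition is found without topology on the character space. Let P be the
cone of sums of the star(b) b, and let W_chi be the sum over the given a of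
star(a - chi(a)) (a - chi(a)), an element on which chi vanishes. The P-module
generated by the elements W_chi - eta contains -1: otherwise a maximal proper
P-module containing it is total on self-adjoint elements, hence is the
nonnegativity cone of a character chi (character_sup), and chi(W_chi - eta) =
-eta < 0 is a contradiction. An expression of -1 in that module is a finite
family e_j in P with characters chi_j whose weighted variance, the sum of the
e_j W_(chi_j), is at most eta times the sum of the e_j; a truncated geometric
series normalizes the sum of the e_j to 1 (partition_of_unity).

Completeness of A and H enters through square roots. In A, every self-adjoint
x of norm less than 1 has 1 - x = y^2 with y self-adjoint, which makes P
archimedean (cstar_arch). The same fixed-point argument in B(H) gives the
roots T_j (sqrt_op); it is carried out once, for both algebras, in
sqrt_one_minus. The error of the approximation is bounded by the Cauchy-
Schwarz inequality for phi (ucp_cauchy_schwarz), which is positivity of phi on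
2 x 2 matrices. The same inequality gives extremality: if chi(a) = 0 then each
phi_i in a decomposition of a |-> chi(a) 1 kills star(a) a, hence a. *)

(** * Powers of a number in [0, 1) *)

Lemma expr_small (R : realType) (r e : R) : 0 <= r < 1 -> 0 < e ->
  exists n, r ^+ n < e.
Proof.
move=> /andP[r0 r1] e0.
have := @cvg_expr R r; rewrite ger0_norm// => /(_ r1) /cvgrPdist_lt /(_ _ e0).
move=> [n _ /(_ n (leqnn n))]/=; rewrite sub0r normrN ger0_norm ?exprn_ge0// => rn.
by exists n.
Qed.

Lemma expr_smallC (R : realType) (r e : R[i]) : 0 <= r < 1 -> 0 < e ->
  exists n, r ^+ n < e.
Proof.
move=> /andP[r0 r1] e0.
have /complex_realP[s rE] : r \is Num.real by rewrite ger0_real.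
have /complex_realP[d eE] : e \is Num.real by rewrite gtr0_real.
rewrite {}rE {}eE in r0 r1 e0 *; move: r0 r1 e0.
rewrite (lecR 0 s) (ltcR s 1) (ltcR 0 d) => s0 s1 d0.
have [n sn] : exists n, s ^+ n < d by apply: expr_small; rewrite ?s0.
by exists n; rewrite -rmorphXn/= ltcR.
Qed.

(** * Sums of hermitian squares, characters and partitions of unity *)

Section StarRing.
Variables (R : realType) (B : comNzRingType).
Variables (k : {rmorphism R[i] -> B}) (st : {rmorphism B -> B}).
Hypothesis stK : involutive st.
Hypothesis st_k : forall z, st (k z) = k z^*.

(** An inductive sum rather than a finite family, so that proofs about positive
elements are inductions that add a single square. *)
Inductive psd : B -> Prop :=
| psd0 : psd 0
| psdS b p of psd p : psd (st b * b + p).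

Lemma psd_sq b : psd (st b * b).
Proof. by rewrite -[_ * _]addr0; apply: psdS psd0. Qed.

Lemma psdD p q : psd p -> psd q -> psd (p + q).
Proof.
move=> pp pq; elim: pp => [|b p' _ IH]; rewrite ?add0r// -addrA; exact: psdS.
Qed.

(** By commutativity, a product of two hermitian squares is the hermitian square of
the product. *)
Lemma psdM p q : psd p -> psd q -> psd (p * q).
Proof.
move=> pp pq; elim: pp => [|b p' _ IH]; first by rewrite mul0r; exact: psd0.
rewrite mulrDl; apply: psdD => {IH}//.
elim: pq => [|c q' _ IH]; first by rewrite mulr0; exact: psd0.
rewrite mulrDr; apply: psdD => //.
have -> : st b * b * (st c * c) = st (b * c) * (b * c) by rewrite rmorphM/=; ring.
exact: psd_sq.
Qed.

Lemma psd_sa p : psd p -> st p = p.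
Proof.
by elim=> [|b p' _ IH]; rewrite ?rmorph0// rmorphD rmorphM/= stK IH mulrC.
Qed.

Lemma k_sa z : 0 <= z -> st (k z) = k z.
Proof. by move=> z0; rewrite st_k geC0_conj. Qed.

Lemma psd_k z : 0 <= z -> psd (k z).
Proof.
move=> z0; have -> : z = (sqrtC z)^* * sqrtC z.
  by rewrite geC0_conj ?sqrtC_ge0// -expr2 sqrtCK.
by rewrite rmorphM/= -st_k; exact: psd_sq.
Qed.

Lemma psd1 : psd 1.
Proof. by rewrite -(rmorph1 k); apply: psd_k. Qed.

Lemma psd_sqr a : st a = a -> psd (a * a).
Proof. by move=> sa; have := psd_sq a; rewrite sa. Qed.

Lemma psd_sum (I : Type) (r : seq I) (P : pred I) (F : I -> B) :
  (forall i, psd (F i)) -> psd (\sum_(i <- r | P i) F i).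
Proof. by move=> F0; elim/big_ind: _ => [||//]; [exact: psd0|exact: psdD]. Qed.

Lemma k_half : k 2^-1 + k 2^-1 = 1.
Proof. by rewrite -rmorphD/= -[X in X + X]mul1r -splitr rmorph1. Qed.

Hypothesis arch : forall a, exists2 K, 0 <= K & psd (k K - st a * a).

(** For self-adjoint a both 1 + a/2 and 1 - a/2 have a psd square, and the linear
terms of these squares are a and -a; the quadratic term is bounded by arch. *)
Lemma psd_bound a : st a = a ->
  exists2 K, 0 < K & psd (k K - a) /\ psd (k K + a).
Proof.
move=> sa; have [K K0] := arch (k 2^-1 * a).
have h2 := k_half; set h := k 2^-1 in h2 *.
have sb : st (h * a) = h * a by rewrite rmorphM/= k_sa ?sa// invr_ge0 ler0n.
rewrite sb => KP; exists (K + 1); first by rewrite ltr_wpDl.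
have s1 : st (1 - h * a) = 1 - h * a by rewrite rmorphB sb rmorph1.
have s2 : st (1 + h * a) = 1 + h * a by rewrite rmorphD sb rmorph1.
have aE : a = h * a + h * a by rewrite -mulrDl h2 mul1r.
split.
  have -> : k (K + 1) - a = k K - h * a * (h * a) + (1 - h * a) * (1 - h * a).
    by rewrite rmorphD rmorph1 {1}aE; ring.
  exact: psdD (psd_sqr s1).
have -> : k (K + 1) + a = k K - h * a * (h * a) + (1 + h * a) * (1 + h * a).
  by rewrite rmorphD rmorph1 {1}aE; ring.
exact: psdD (psd_sqr s2).
Qed.

(** A cone over psd that behaves like the nonnegativity cone of a point. Closure
under multiplication by psd elements only, rather than under products, keeps the
module generated by an element linear in that element. *)
Record pmodule (M : B -> Prop) : Prop := PModule {
  pm_psd : forall p, psd p -> M p ;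
  pm_sa : forall a, M a -> st a = a ;
  pmD : forall a b, M a -> M b -> M (a + b) ;
  pmM : forall p a, psd p -> M a -> M (p * a) ;
  pm_proper : ~ M (-1) }.

(** Zorn's lemma for the sets whose union with M0 is a P-module; taking the union
makes the empty chain harmless. *)
Lemma pmodule_max (M0 : B -> Prop) : pmodule M0 -> exists M : B -> Prop,
  [/\ pmodule M, forall a, M0 a -> M a &
      forall N : B -> Prop, pmodule N -> (forall a, M a -> N a) -> forall a, N a -> M a].
Proof.
move=> pM0; pose P := [set X : set B | pmodule (M0 `|` X)].
have [F FP Ftot|X [PX Xmax]] := @Zorn_bigcup _ P.
- have PF X : F X -> pmodule (M0 `|` X) by move=> /FP.
  pose U := M0 `|` \bigcup_(X in F) X.
  have mono X : F X -> (M0 `|` X) `<=` U.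
    by move=> FX a [|aX]; [left|right; exists X].
  have U1 a : U a -> exists N : set B, [/\ pmodule N, N a & N `<=` U].
    case=> [aM|[X FX aX]]; first by exists M0; split=> // b; left.
    by exists (M0 `|` X); split; [exact: PF|right|exact: mono].
  have U2 a b : U a -> U b -> exists N : set B, [/\ pmodule N, N a, N b & N `<=` U].
    case=> [aM|[X FX aX]] => -[bM|[Y FY bY]].
    + by exists M0; split=> // c; left.
    + by exists (M0 `|` Y); split; [exact: PF|left|right|exact: mono].
    + by exists (M0 `|` X); split; [exact: PF|right|left|exact: mono].
    have [XY|YX] := Ftot _ _ FX FY.
      by exists (M0 `|` Y); split; [exact: PF|right; exact: XY|right|exact: mono].
    by exists (M0 `|` X); split; [exact: PF|right|right; exact: YX|exact: mono].
  split.
  + by move=> p pp; left; exact: pm_psd.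
  + by move=> a /U1[N [pN Na _]]; exact: pm_sa pN _ Na.
  + by move=> a b Ua Ub; have [N [pN Na Nb NU]] := U2 _ _ Ua Ub; apply/NU/(pmD pN).
  + by move=> p a pp /U1[N [pN Na NU]]; apply/NU/(pmM pN).
  + by move=> /U1[N [pN N1 _]]; exact: pm_proper pN N1.
- exists (M0 `|` X); split=> // [a M0a|N pN MN]; first by left.
  apply: contrapT => nNM; apply: (Xmax N).
    split=> [a Xa|NX]; first by apply: MN; right.
    by apply: nNM => a Na; right; exact: NX.
  suff NE : M0 `|` N = N by rewrite /P/= NE.
  by apply/seteqP; split=> [a [M0a|//]|a Na]; [apply: MN; left|right].
Qed.

(** The axioms of a unital homomorphism to the complex numbers that respects the
involution; cancellation of k carries linearity. *)
Definition character (chi : B -> R[i]) : Prop :=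
  [/\ {morph chi : a b / a + b}, {morph chi : a b / a * b}, cancel k chi
    & forall a, chi (st a) = (chi a)^*].

Section MaximalModule.
Variable M : B -> Prop.
Hypothesis pM : pmodule M.

Lemma pm_ge0 z : 0 <= z -> M (k z).
Proof. by move=> z0; apply/(pm_psd pM)/psd_k. Qed.

Lemma pm_lt0 z : z < 0 -> ~ M (k z).
Proof.
move=> z0 Mz; apply: (pm_proper pM).
have := pmM pM (@psd_k (- z^-1) _) Mz; rewrite -rmorphM/= mulNr mulVf ?lt_eqF//.
by rewrite rmorphN1; apply; rewrite oppr_ge0 ltW// invr_lt0.
Qed.

Hypothesis Mmax : forall N : B -> Prop, pmodule N ->
  (forall a, M a -> N a) -> forall a, N a -> M a.

(** By maximality the module generated by M and a is improper. *)
Lemma pm_adjoin a : st a = a -> ~ M a ->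
  exists p m, [/\ psd p, M m & -1 = m + p * a].
Proof.
move=> sa nMa; apply: contrapT => no.
apply: nMa; pose N b := exists p m, [/\ psd p, M m & b = m + p * a].
have MN b : M b -> N b.
  by move=> Mb; exists 0, b; split=> //; [exact: psd0|rewrite mul0r addr0].
apply: (Mmax (N := N)) => //; last first.
  exists 1, 0; split; [exact: psd1|exact/(pm_psd pM)/psd0|by rewrite add0r mul1r].
split=> [p pp|b|b c|q b pq|//].
- exact/MN/(pm_psd pM).
- move=> [p [m [pp Mm ->]]].
  by rewrite rmorphD rmorphM/= sa (psd_sa pp) (pm_sa pM Mm).
- move=> [p [m [pp Mm ->]]] [q [n [pq Mn ->]]]; exists (p + q), (m + n).
  split; [exact: psdD|exact: (pmD pM)|by ring].
- move=> [p [m [pp Mm ->]]]; exists (q * p), (q * m).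
  by split; [exact: psdM|exact: (pmM pM)|ring].
Qed.

(** If neither a nor -a lies in M, then -1 = m + p a = n - q a with p, q psd.
Eliminating a gives -(p + q) in M, so that M contains p and -p. Since a is
bounded, M then contains p a, and hence -1. *)
Lemma pm_total a : st a = a -> M a \/ M (- a).
Proof.
move=> sa; apply: contrapT => /not_orP[nMa nMna].
have sNa : st (- a) = - a by rewrite rmorphN sa.
have [p [m [pp Mm E1]]] := pm_adjoin sa nMa.
have [q [n [pq Mn E2]]] := pm_adjoin sNa nMna.
(* q times the first decomposition plus p times the second: the terms in a cancel. *)
have Mpq : M (- (p + q)).
  have -> : - (p + q) = q * m + p * n.
    rewrite opprD; have -> : - p = p * -1 by ring.
    have -> : - q = q * -1 by ring.
    by rewrite {1}E2 E1; ring.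
  by apply: (pmD pM); apply: (pmM pM).
have MNp : M (- p).
  have -> : - p = - (p + q) + q by ring.
  by apply: (pmD pM) => //; exact: (pm_psd pM).
have [K K0 [_ Ka]] := psd_bound sa.
have Mpa : M (p * a).
  have -> : p * a = (k K + a) * p + k K * - p by ring.
  apply: (pmD pM); first exact/(pm_psd pM)/psdM.
  by apply: (pmM pM) => //; exact/psd_k/ltW.
by apply: (pm_proper pM); rewrite E1; exact: (pmD pM).
Qed.

(** The elements that are infinitesimal for the order M. They form the kernel of
the character under construction. *)
Definition null a := forall e, 0 < e -> M (k e - st a * a).

Lemma nullD a b : null a -> null b -> null (a + b).
Proof.
move=> na nb e e0; pose f := 2^-1 * (2^-1 * e).
have f0 : 0 < f by rewrite !mulr_gt0// invr_gt0 ltr0n.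
have eE : k e = k f + k f + k f + k f.
  rewrite -!rmorphD/= /f; congr (k _).
  by field.
have -> : k e - st (a + b) * (a + b) =
    (k f - st a * a) + (k f - st a * a) + (k f - st b * b) + (k f - st b * b) +
    st (a - b) * (a - b) by rewrite eE rmorphD rmorphB/=; ring.
apply: (pmD pM); last exact/(pm_psd pM)/psd_sq.
do 2 (apply: (pmD pM); last exact: nb).
by apply: (pmD pM); exact: na.
Qed.
Lemma nullMl a b : null a -> null (b * a).
Proof.
move=> na e e0; have [K0 K00 KP0] := arch b.
pose K := K0 + 1; have K0' : 0 < K by rewrite ltr_wpDl.
have KP : psd (k K - st b * b).
  rewrite rmorphD rmorph1 addrAC; exact: psdD psd1.
pose f := e / K; have f0 : 0 < f by rewrite divr_gt0.
have eE : k e = k f * k K by rewrite -rmorphM/= /f divfK// gt_eqF.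
have -> : k e - st (b * a) * (b * a) =
    st b * b * (k f - st a * a) + k f * (k K - st b * b).
  by rewrite eE rmorphM/=; ring.
apply: (pmD pM); first by apply: (pmM pM); [exact: psd_sq|exact: na].
by apply/(pm_psd pM)/psdM => //; exact/psd_k/ltW.
Qed.

Lemma null_st a : null a -> null (st a).
Proof. by move=> na e e0; rewrite stK mulrC; exact: na. Qed.

Lemma null_k z : null (k z) -> z = 0.
Proof.
move=> nz; apply/eqP/negPn/negP => z0.
have w0 : 0 < z^* * z by rewrite mulrC -normCK exprn_gt0// normr_gt0.
have := nz _ (mulr_gt0 (_ : 0 < 2^-1) w0).
rewrite invr_gt0 ltr0n => /(_ isT); rewrite st_k -rmorphM -rmorphB.
apply: pm_lt0; rewrite -[X in _ - X]mul1r -mulrBl pmulr_llt0//.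
by rewrite subr_lt0 invf_lt1 ?ltr0n// ltr1n.
Qed.

(** The value at a is the supremum of the r with a - r in M, by totality. *)
Lemma pm_approx_sa a : st a = a -> exists z, null (a - k z).
Proof.
move=> sa; pose S := [set r : R | M (a - k r%:C%C)].
have [K K0 [Kl Ku]] := psd_bound sa.
have /complex_realP[kap KE] : K \is Num.real by rewrite gtr0_real.
rewrite {}KE in K0 Kl Ku.
have Sub r : S r -> r <= kap.
  move=> Sr; rewrite leNgt; apply/negP => kr.
  apply: (@pm_lt0 (kap%:C%C - r%:C%C)); first by rewrite subr_lt0 ltcR.
  rewrite rmorphB/=.
  have -> : k kap%:C%C - k r%:C%C = (k kap%:C%C - a) + (a - k r%:C%C) by ring.
  by apply: (pmD pM) => //; exact: (pm_psd pM).
have S0 : S !=set0.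
  by exists (- kap); rewrite /S/= rmorphN rmorphN/= opprK addrC; exact: (pm_psd pM).
have hS : has_sup S by split=> //; exists kap => r /Sub.
pose s := sup S; pose d := a - k s%:C%C.
have lo (e : R) : 0 < e -> M (k e%:C%C + d).
  move=> e0; have [r Sr sr] := sup_adherent e0 hS.
  have -> : k e%:C%C + d = (a - k r%:C%C) + k (r - (s - e))%:C%C.
    by rewrite /d !rmorphB/=; ring.
  by apply: (pmD pM) => //; apply: pm_ge0; rewrite ler0c subr_ge0 ltW.
have up (e : R) : 0 < e -> M (k e%:C%C - d).
  move=> e0; have sd : st (a - k (s + e)%:C%C) = a - k (s + e)%:C%C.
    by rewrite rmorphB sa st_k conj_Creal//; apply/complex_realP; exists (s + e).
  have [Ms|] := pm_total sd.
    have : s + e <= s by apply: ub_le_sup => //; case: hS.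
    by rewrite gerDl leNgt e0.
  by congr M; rewrite /d !rmorphD/=; ring.
exists s%:C%C; rewrite -/d.
have sd : st d = d.
  by rewrite rmorphB sa st_k conj_Creal//; apply/complex_realP; exists s.
clear K kap Kl Ku K0 Sub S0; have [K K0 [Kl Ku]] := psd_bound sd.
move=> e e0; rewrite sd; have h2 := k_half; set h := k 2^-1 in h2 *.
pose f := e / K; have f0 : 0 < f by rewrite divr_gt0.
have eE : k e = k f * k K by rewrite -rmorphM/= /f divfK// gt_eqF.
have /complex_realP[g fE] : f \is Num.real by rewrite gtr0_real.
have g0 : 0 < g by rewrite -ltcR -fE.
(* M is not closed under products, so both factors that multiply an element of M
are psd: the bounds K + d and K - d. *)
have -> : k e - d * d = h * ((k K + d) * (k f - d) + (k K - d) * (k f + d)).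
  transitivity ((h + h) * (k e - d * d)); first by rewrite h2 mul1r.
  by rewrite eE; ring.
apply: (pmM pM); first by apply: psd_k; rewrite invr_ge0 ler0n.
by rewrite fE; apply: (pmD pM); apply: (pmM pM) => //; [exact: up|exact: lo].
Qed.

Lemma pm_approx a : exists z, null (a - k z).
Proof.
pose h := k 2^-1; pose I := k 'i.
have II : I * I = -1 by rewrite -rmorphM/= -expr2 sqrCi rmorphN1.
have stI : st I = - I by rewrite st_k conjCi rmorphN.
have sth : st h = h by rewrite k_sa// invr_ge0 ler0n.
pose u := h * (a + st a); pose v := - I * (h * (a - st a)).
have su : st u = u by rewrite rmorphM rmorphD/= stK sth addrC.
have sv : st v = v.
  by rewrite rmorphM rmorphN rmorphM rmorphB/= stK sth stI /v; ring.
have aE : a = u + I * v.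
  have -> : u + I * v = h * (a + st a) - (I * I) * (h * (a - st a)).
    by rewrite /u /v; ring.
  rewrite -[LHS]mul1r -k_half -/h.
  by rewrite II; ring.
have [r nr] := pm_approx_sa su; have [s ns] := pm_approx_sa sv.
exists (r + 'i * s).
have -> : a - k (r + 'i * s) = (u - k r) + I * (v - k s).
  by rewrite {1}aE rmorphD rmorphM/=; ring.
by apply: nullD => //; exact: nullMl.
Qed.

(** Every a differs from exactly one scalar by an infinitesimal; this scalar is the
value of the character at a. *)
Lemma pm_character : exists2 chi, character chi & forall a, M a -> 0 <= chi a.
Proof.
have [chi chiP] := choice pm_approx.
have chi_uniq a z : null (a - k z) -> chi a = z.
  move=> nz; apply/eqP; rewrite -subr_eq0; apply/eqP/null_k.
  have -> : k (chi a - z) = (a - k z) + (-1) * (a - k (chi a)).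
    by rewrite rmorphB/=; ring.
  by apply: nullD => //; exact: nullMl.
have chiJ a : chi (st a) = (chi a)^*.
  by apply: chi_uniq; rewrite -st_k -rmorphB; exact: null_st.
exists chi.
  split=> // [a b|a b|z].
  - apply: chi_uniq; rewrite rmorphD/=.
    have -> : a + b - (k (chi a) + k (chi b)) = (a - k (chi a)) + (b - k (chi b)) by ring.
    exact: nullD.
  - apply: chi_uniq; rewrite rmorphM/=.
    have -> : a * b - k (chi a) * k (chi b) =
      b * (a - k (chi a)) + k (chi a) * (b - k (chi b)) by ring.
    by apply: nullD; exact: nullMl.
  - apply: chi_uniq; rewrite subrr => e e0; rewrite mulr0 subr0.
    exact/pm_ge0/ltW.
move=> a Ma; have sa := pm_sa pM Ma.
have : chi a \is Num.real by rewrite CrealE -chiJ sa.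
rewrite realE => /orP[//|]; rewrite le_eqVlt => /predU1P[->//|c0].
have := chiP a; set c := chi a in c0 *; set d := a - k c => nd.
exfalso; have := nd (2^-1 * (c * c)) _.
have cc0 : 0 < c * c by rewrite nmulr_rgt0.
rewrite mulr_gt0 ?invr_gt0 ?ltr0n// => /(_ isT) Md.
apply: (@pm_lt0 (2^-1 * (c * c) - c * c)).
  by rewrite -[X in _ - X]mul1r -mulrBl pmulr_llt0// subr_lt0 invf_lt1 ?ltr0n// ltr1n.
have sd : st d = d by rewrite rmorphB sa st_k conj_Creal// ltr0_real.
have -> : k (2^-1 * (c * c) - c * c) = (k (2^-1 * (c * c)) - st d * d) +
   a * a + (k (- c) + k (- c)) * a.
  by rewrite sd /d rmorphB/= !rmorphM/= !rmorphN/=; ring.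
apply: (pmD pM); first (apply: (pmD pM) => //; exact/(pm_psd pM)/psd_sqr).
apply: (pmM pM) => //; rewrite -rmorphD; apply: psd_k.
by rewrite addr_ge0// oppr_ge0 ltW.
Qed.

End MaximalModule.

Lemma character_sup (M : B -> Prop) : pmodule M ->
  exists2 chi, character chi & forall a, M a -> 0 <= chi a.
Proof.
move=> /pmodule_max[N [pN MN Nmax]].
have [chi cchi chi0] := pm_character pN Nmax.
by exists chi => // a /MN/chi0.
Qed.

Lemma characterB chi a b : character chi -> chi (a - b) = chi a - chi b.
Proof.
move=> [chiD _ _ _].
by apply/eqP; rewrite eq_sym subr_eq -chiD subrK.
Qed.

(** The variance of the family t around the point chi, as an element of B. *)
Definition spread (t : seq B) (chi : B -> R[i]) :=
  \sum_(a <- t) st (a - k (chi a)) * (a - k (chi a)).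

Lemma psd_spread t chi : psd (spread t chi).
Proof. by apply: psd_sum => a; exact: psd_sq. Qed.

Lemma character_spread t chi : character chi -> chi (spread t chi) = 0.
Proof.
move=> cchi; have [chiD chiM chiK _] := cchi.
have chi0 : chi 0 = 0 by rewrite -(rmorph0 k) chiK.
rewrite /spread (big_morph _ chiD chi0) big1// => a _.
by rewrite chiM [X in _ * X]characterB// chiK subrr mulr0.
Qed.

(** The P-module generated by the elements spread t chi - eta, over all characters. *)
Inductive spread_module (t : seq B) (eta : R[i]) : B -> Prop :=
| spread_psd p of psd p : spread_module t eta p
| spread_add e chi a of psd e & character chi & spread_module t eta a :
    spread_module t eta (e * (spread t chi - k eta) + a).

Lemma spread_moduleP t eta a : spread_module t eta a ->
  exists m (e : 'I_m -> B) (chi : 'I_m -> B -> R[i]) p,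
  [/\ psd p, forall j, psd (e j), forall j, character (chi j) &
      a = p + \sum_j e j * (spread t (chi j) - k eta)].
Proof.
elim=> [p pp|e chi {}a pe cchi _ [m [f [psi [p [pp pf cpsi ->]]]]]].
  exists 0, (fun=> 0), (fun=> fun=> 0), p; split=> // [[]//|[]//|].
  by rewrite big_ord0 addr0.
exists m.+1, (fun i => if unlift ord0 i is Some j then f j else e),
  (fun i => if unlift ord0 i is Some j then psi j else chi), p.
split=> // [i|i|].
- by case: unlift.
- by case: unlift.
rewrite big_ord_recl unlift_none addrCA; congr (_ + (_ + _)).
by apply: eq_bigr => i _; rewrite liftK.
Qed.

(** A character nonnegative on this module would be nonnegative at -eta, since its
own spread vanishes at it. So no proper P-module contains the generators. *)
Lemma spread_moduleN1 t eta : 0 < eta -> spread_module t eta (-1).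
Proof.
move=> eta0; apply: contrapT => nN1.
have pmS : pmodule (spread_module t eta).
  split=> //.
  - by move=> p; exact: spread_psd.
  - move=> a; elim=> [p /psd_sa//|e chi {}a pe _ _ IH].
    rewrite rmorphD rmorphM rmorphB/= IH !psd_sa//.
      exact/psd_k/ltW.
    exact: psd_spread.
  - move=> a b Sa Sb; elim: Sa => [p pp|e chi {}a pe cchi _ IH]; last first.
      by rewrite -addrA; exact: spread_add.
    elim: Sb => [q pq|e chi {}b pe cchi _ IH]; first exact/spread_psd/psdD.
    by rewrite addrCA; exact: spread_add.
  - move=> p a pp; elim=> [q pq|e chi {}a pe cchi _ IH].
      exact/spread_psd/psdM.
    by rewrite mulrDr mulrA; apply: spread_add => //; exact: psdM.
have [chi cchi chi0] := character_sup pmS.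
have S : spread_module t eta (spread t chi - k eta).
  rewrite -[_ - _]mul1r -[1 * _]addr0.
  by apply: spread_add => //; [exact: psd1|exact/spread_psd/psd0].
have [_ _ chiK _] := cchi.
have := chi0 _ S; rewrite characterB// character_spread// chiK.
by rewrite sub0r oppr_ge0 (lt_geF eta0).
Qed.

(** Writing -1 in the spread module gives eta times the sum of the e_j as 1 plus the
weighted variance plus a psd term. The spare 1 pays for adding the same small
constant to every e_j, which makes them bounded below. *)
Lemma near_partition (t : seq B) (eta : R[i]) : 0 < eta -> ~ psd (-1) ->
  exists m (e : 'I_m -> B) (chi : 'I_m -> B -> R[i]) (c : R[i]),
  [/\ 0 < c, forall j, psd (e j - k c), forall j, character (chi j)
    & psd (k eta * \sum_j e j - \sum_j e j * spread t (chi j)) /\ (0 < m)%N].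
Proof.
move=> eta0 N1.
have [m [e [chi [p [pp pe cchi E]]]]] := spread_moduleP (spread_moduleN1 t eta0).
case: m e chi pe cchi E => [|m] e chi pe cchi E.
  by exfalso; apply: N1; rewrite E big_ord0 addr0.
pose W := \sum_j spread t (chi j).
have pW : psd W by apply: psd_sum => j; exact: psd_spread.
have [K K0 [KW _]] := psd_bound (psd_sa pW).
(* K bounds the sum of the spreads, so adding 1/K to each e_j costs at most 1. *)
exists m.+1, (fun j => e j + k K^-1), chi, K^-1; split=> //.
- by rewrite invr_gt0.
- by move=> j; rewrite addrK.
split=> //.
have {}E : k eta * (\sum_j e j) - \sum_j e j * spread t (chi j) = 1 + p.
  rewrite -[1]opprK E; rewrite mulr_sumr -sumrB opprD addrAC addNr add0r -sumrN.
  by apply: eq_bigr => j _; ring.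
have -> : \sum_j (e j + k K^-1) * spread t (chi j) =
    \sum_j e j * spread t (chi j) + k K^-1 * W.
  by rewrite /W mulr_sumr -big_split/=; apply: eq_bigr => j _; rewrite mulrDl.
have KK : k K^-1 * k K = 1 by rewrite -rmorphM/= mulVf ?gt_eqF// rmorph1.
have pK : psd (k K^-1) by apply/psd_k/ltW; rewrite invr_gt0.
rewrite big_split/=; set V := \sum_j e j * _ in E *; set q := \sum_j e j in E *.
set r := \sum_(j < m.+1) k K^-1.
have -> : k eta * (q + r) - (V + k K^-1 * W) =
    (k eta * q - V) - k K^-1 * k K + k eta * r + k K^-1 * (k K - W) by ring.
rewrite E KK; have -> : 1 + p - 1 = p by ring.
apply: psdD; last exact: psdM.
by apply: psdD => //; apply: psdM; [exact/psd_k/ltW|exact: psd_sum].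
Qed.

(** It remains to divide by q, the sum of the e_j of near_partition. As c <= q <= K,
the element x = 1 - q/K satisfies 0 <= x <= rho < 1, and s = (1 + x + ... +
x^(n-1))/K is an approximate inverse: q s = 1 - x^n. The remainder x^n is
distributed evenly over the terms e_j s; it is at most rho^n, so that its
contribution to the variance is small for large n. *)
Lemma partition_of_unity (t : seq B) (eta : R[i]) : 0 < eta -> ~ psd (-1) ->
  exists m (e : 'I_m -> B) (chi : 'I_m -> B -> R[i]) (c : R[i]),
  [/\ 0 < c < 1, forall j, psd (e j - k c), forall j, character (chi j),
    \sum_j e j = 1 & psd (k eta - \sum_j e j * spread t (chi j))].
Proof.
move=> eta0' N1; pose eta' := 2^-1 * eta.
have eta'0 : 0 < eta' by rewrite mulr_gt0// invr_gt0 ltr0n.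
have etaE : eta = eta' + eta' by rewrite /eta'; field.
have [m [e [chi [c [c0 pe cchi [pD m0]]]]]] := near_partition t eta'0 N1.
set q := \sum_j e j in pD *; set V := \sum_j e j * _ in pD *.
have pe' j : psd (e j) by rewrite -[e j](subrK (k c)); apply: psdD => //; exact/psd_k/ltW.
have pq : psd q by exact: psd_sum.
pose W := \sum_j spread t (chi j).
have pW : psd W by apply: psd_sum => j; exact: psd_spread.
have [L L0 [LW _]] := psd_bound (psd_sa pW).
have [K1 K10 [Kq _]] := psd_bound (psd_sa pq).
pose K := K1 + c; have K0 : 0 < K by rewrite addr_gt0.
have {}Kq : psd (k K - q).
  by rewrite rmorphD addrAC; apply: psdD => //; exact/psd_k/ltW.
have pc : psd (q - k c).
  rewrite /q (bigD1 (Ordinal m0))//= addrAC; apply: psdD => //.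
  exact: psd_sum.
pose x := k K^-1 * (k K - q).
have KK : k K^-1 * k K = 1 by rewrite -rmorphM/= mulVf ?gt_eqF// rmorph1.
have pKV : psd (k K^-1) by apply/psd_k/ltW; rewrite invr_gt0.
have px : psd x by exact: psdM.
pose rho := 1 - c / K.
have rho01 : 0 <= rho < 1.
  rewrite subr_ge0 ler_pdivrMr// mul1r lerDr (ltW K10)/=.
  by rewrite gtrDl oppr_lt0 divr_gt0.
have rx : psd (k rho - x).
  have -> : k rho - x = k K^-1 * (q - k c).
    rewrite rmorphB rmorph1 rmorphM/= /x -KK; ring.
  exact: psdM.
have pxn n : psd (x ^+ n).
  by elim: n => [|n IH]; [exact: psd1|rewrite exprS; exact: psdM].
have rxn n : psd (k rho ^+ n - x ^+ n).
  elim: n => [|n IH]; first by rewrite subrr; exact: psd0.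
  have -> : k rho ^+ n.+1 - x ^+ n.+1 =
    k rho * (k rho ^+ n - x ^+ n) + x ^+ n * (k rho - x) by rewrite !exprS; ring.
  apply: psdD; apply: psdM => //; apply: psd_k; by case/andP: rho01.
have [n0 rn0] := expr_smallC rho01 (divr_gt0 eta'0 L0).
(* At least one term of the geometric series, so that s is bounded below. *)
pose n := n0.+1.
have rn : L * rho ^+ n <= eta'.
  rewrite mulrC -ler_pdivlMr// exprS; apply: le_trans (ltW rn0).
  have /andP[r0 r1] := rho01.
  by rewrite ler_piMl ?exprn_ge0// ltW.
pose s := k K^-1 * \sum_(i < n) x ^+ i.
have qs : q * s = 1 - x ^+ n.
  have -> : 1 - x ^+ n = - (x ^+ n - 1) by ring.
  have -> : q * s = - ((x - 1) * \sum_(i < n) x ^+ i); last by rewrite -subrX1.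
  by rewrite /s /x -KK; ring.
have ps1 : psd (s - k K^-1).
  rewrite /s big_ord_recl expr0 mulrDr mulr1 addrAC subrr add0r.
  by apply: psdM => //; apply: psd_sum.
have ps : psd s by rewrite -[s](subrK (k K^-1)); exact: psdD.
pose w := k (m%:R^-1).
have mC : m%:R != 0 :> R[i] by rewrite pnatr_eq0 -lt0n.
have pw : psd w by apply: psd_k; rewrite invr_ge0 ler0n.
have mw : \sum_(j < m) w = 1.
  by rewrite sumr_const card_ord -[w *+ m]mulr_natl -(rmorph_nat k)
    -rmorphM/= divff// rmorph1.
exists m, (fun j => e j * s + w * x ^+ n), chi, (c / K); split=> //.
- by rewrite divr_gt0//= ltr_pdivrMr// mul1r ltrDr.
- move=> j; have -> : e j * s + w * x ^+ n - k (c / K) =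
    (e j - k c) * s + k c * (s - k K^-1) + w * x ^+ n by rewrite rmorphM/=; ring.
  apply: psdD; last exact: psdM.
  by apply: psdD; apply: psdM => //; exact/psd_k/ltW.
- rewrite big_split/= -mulr_suml -/q qs -mulr_suml mw mul1r; ring.
have -> : \sum_j (e j * s + w * x ^+ n) * spread t (chi j) = s * V + w * x ^+ n * W.
  rewrite /V /W !mulr_sumr -big_split/=; apply: eq_bigr => j _; ring.
have -> : k eta - (s * V + w * x ^+ n * W) =
  s * (k eta' * q - V) + k eta' * x ^+ n + w * x ^+ n * (k L - W)
  + w * k L * (k rho ^+ n - x ^+ n)
  + (k eta' - w * k (L * rho ^+ n)).
  rewrite etaE rmorphD [k (L * _)]rmorphM rmorphXn/=.
  transitivity (k eta' * (q * s) + k eta' * x ^+ n + k eta' - (s * V + w * x ^+ n * W)).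
    by rewrite qs; ring.
  ring.
have pe0 : psd (k eta') by exact/psd_k/ltW.
have pL : psd (k L) by exact/psd_k/ltW.
apply: psdD.
  apply: psdD; last by apply: psdM => //; exact: psdM.
  apply: psdD; last by apply: psdM => //; exact: psdM.
  exact: psdD (psdM ps pD) (psdM pe0 (pxn n)).
rewrite /w -rmorphM -rmorphB; apply: psd_k; rewrite subr_ge0.
apply: le_trans rn; rewrite ler_piMl//.
  by have /andP[r0 _] := rho01; rewrite mulr_ge0 ?exprn_ge0// ltW.
by rewrite invf_le1 ?ltr0n// ler1n.
Qed.

End StarRing.

(** * Square roots of elements close to 1 *)

Section GeometricLimit.
Variables (R : realType) (V : completeNormedModType R[i]).

(** The explicit rate lets every later passage to the limit be an application of
geometric_eq0. *)
Lemma geometric_limit (u : nat -> V) (r D : R) : 0 <= r < 1 -> 0 <= D ->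
  (forall n, `|u n.+1 - u n| <= (D * r ^+ n)%:C%C) ->
  exists l, forall n, `|l - u n| <= (D * r ^+ n / (1 - r))%:C%C.
Proof.
move=> r01 D0 uD; have /andP[r0 r1] := r01.
have r1' : 0 < 1 - r by rewrite subr_gt0.
have tail n m : `|u (n + m)%N - u n| <= (D * r ^+ n * (1 - r ^+ m) / (1 - r))%:C%C.
  elim: m => [|m IH]; first by rewrite addn0 !subrr mulr0 mul0r normr0.
  rewrite addnS -(subrKA (u (n + m)%N)) (le_trans (ler_normD _ _))//.
  apply: le_trans (lerD (uD _) IH) _.
  rewrite -rmorphD/= lecR exprD exprS le_eqVlt; apply/orP; left; apply/eqP.
  by field; rewrite gt_eqF.
have tail' n m : `|u (n + m)%N - u n| <= (D * r ^+ n / (1 - r))%:C%C.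
  apply: le_trans (tail n m) _; rewrite lecR ler_pM2r ?invr_gt0//.
  rewrite ler_piMr ?mulr_ge0 ?exprn_ge0// gerBl exprn_ge0//.
pose c := D / (1 - r).
have small (e : R) : 0 < e -> exists n, D * r ^+ n / (1 - r) < e.
  move=> e0; have c1 : 0 < c + 1 by rewrite ltr_wpDl// divr_ge0// ltW.
  have [n rn] := expr_small r01 (divr_gt0 e0 c1).
  exists n; rewrite mulrAC; apply: (@le_lt_trans _ _ ((c + 1) * r ^+ n)).
    by rewrite ler_wpM2r ?exprn_ge0// /c lerDl.
  by rewrite mulrC -ltr_pdivlMr.
have cu : cvgn u.
  apply/cauchy_cvgP/cauchy_exP => e e0.
  have /complex_realP[d eE] : e \is Num.real by rewrite gtr0_real.
  rewrite {}eE (ltcR 0) in e0 *; have [n ne] := small _ e0.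
  exists (u n); exists n => // m /= nm.
  rewrite -ball_normE/= distrC -(subnKC nm).
  by apply: le_lt_trans (tail' _ _) _; rewrite ltcR.
exists (limn u) => n; apply/ler_addgt0Pr => e e0.
have /cvgrPdist_lt/(_ _ e0)[m _ um] := cu.
rewrite -(subrKA (u (n + m)%N)) (le_trans (ler_normD _ _))//.
rewrite [leRHS]addrC lerD// ltW//; exact: (um _ (leq_addl _ _)).
Qed.
Lemma geometric_eq0 (W : normedZmodType R[i]) (v : W) (r D : R) : 0 <= r < 1 -> 0 <= D ->
  (forall n, `|v| <= (D * r ^+ n)%:C%C) -> v = 0.
Proof.
move=> r01 D0 vD; apply/eqP; rewrite -normr_le0; apply/ler_addgt0Pr => e e0.
have /complex_realP[d eE] : e \is Num.real by rewrite gtr0_real.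
rewrite {}eE (ltcR 0) in e0 *; have D1 : 0 < D + 1 by rewrite ltr_wpDl.
have [n rn] := expr_small r01 (divr_gt0 e0 D1).
rewrite add0r; apply: le_trans (vD n) _; rewrite lecR.
apply: (@le_trans _ _ ((D + 1) * r ^+ n)).
  by rewrite ler_wpM2r ?lerDl// exprn_ge0//; case/andP: r01.
by rewrite mulrC -ler_pdivlMr// ltW.
Qed.

End GeometricLimit.

Section SquareRoot.
Variables (R : realType) (E : pzRingType).

(** What the square root needs from the self-adjoint part of A or of B(H). The norm
is a relation, bd a m standing for: the norm of a is at most m. The operator norm
thus never has to be defined. The element hf, one half of the unit, stands in for
scalar multiplication. *)
Record complete_normed (bd : E -> R -> Prop) (sa : E -> Prop) (hf : E) : Prop :=
  CompleteNormed {
  bd0 : bd 0 0 ;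
  bd_le : forall a m n, bd a m -> m <= n -> bd a n ;
  bdD : forall a b m n, bd a m -> bd b n -> bd (a + b) (m + n) ;
  bdN : forall a m, bd a m -> bd (- a) m ;
  bdM : forall a b m n, bd a m -> bd b n -> bd (a * b) (m * n) ;
  bd_eq0 : forall a, (forall e, 0 < e -> bd a e) -> a = 0 ;
  bd_half : bd hf 2^-1 ;
  halfD : hf + hf = 1 ;
  sa1 : sa 1 ;
  saB : forall a b, sa a -> sa b -> sa (a - b) ;
  sa_sqr : forall a, sa a -> sa (a * a) ;
  sa_half : forall a, sa a -> sa (hf * a) ;
  bd_complete : forall (u : nat -> E) (r D : R), 0 <= r < 1 -> 0 <= D ->
    (forall n, bd (u n.+1 - u n) (D * r ^+ n)) -> (forall n, sa (u n)) ->
    exists2 l, sa l & forall n, bd (l - u n) (D * r ^+ n / (1 - r)) }.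

Lemma mul_subK (a b : E) : a * a - b * b = a * (a - b) + (a - b) * b.
Proof. by rewrite mulrBr mulrBl subrKA. Qed.

Variables (bd : E -> R -> Prop) (sa : E -> Prop) (hf : E).
Hypothesis cn : complete_normed bd sa hf.

(** With y = 1 - l the equation y^2 = 1 - x becomes l = (x + l^2)/2, whose right-hand
side maps the ball of radius r to itself and contracts it by the factor r. *)
Lemma sqrt_one_minus x r : 0 <= r < 1 -> sa x -> bd x r ->
  exists2 y, sa y & y * y = 1 - x.
Proof.
move=> r01 sx bx; have /andP[r0 r1] := r01.
have s0 : sa 0 by rewrite -(subrr 1); apply: (saB cn); exact: (sa1 cn).
have sD a b : sa a -> sa b -> sa (a + b).
  by move=> sa_ sb; rewrite -[b]opprK -[- b]sub0r; apply: (saB cn) => //; exact: (saB cn).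
pose u := fix u n := if n is n'.+1 then hf * (x + u n' * u n') else 0.
have su n : sa (u n).
  by elim: n => //= n IH; apply/(sa_half cn)/sD => //; exact: (sa_sqr cn).
have bdu n : bd (u n) r.
  elim: n => [|n IH] /=; first exact: (bd_le cn (bd0 cn)).
  apply: (bd_le cn (bdM cn (bd_half cn) (bdD cn bx (bdM cn IH IH)))).
  rewrite mulrC ler_pdivrMr// mulr_natr mulr2n lerD2l ler_piMr// ltW//.
have step n : bd (u n.+1 - u n) (r * r ^+ n).
  elim: n => [|n IH]; first by rewrite expr0 mulr1 subr0; exact: bdu.
  have -> : u n.+2 - u n.+1 =
      hf * (u n.+1 * (u n.+1 - u n) + (u n.+1 - u n) * u n).
    rewrite -mul_subK -[u n.+2]/(hf * (x + u n.+1 * u n.+1)).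
    by rewrite -[X in _ - X = _]/(hf * (x + u n * u n)) -mulrBr opprD addrACA subrr add0r.
  have bDu := bdD cn (bdM cn (bdu n.+1) IH) (bdM cn IH (bdu n)).
  apply: (bd_le cn (bdM cn (bd_half cn) bDu)).
  by rewrite le_eqVlt; apply/orP; left; apply/eqP; rewrite exprS; field.
have [l sl lu] := bd_complete cn r01 r0 step su.
exists (1 - l); first by apply: (saB cn) => //; exact: (sa1 cn).
have r1' : 0 < 1 - r by rewrite subr_gt0.
pose D := r / (1 - r); have D0 : 0 <= D by rewrite divr_ge0// ltW.
have lu' n : bd (l - u n) (D * r ^+ n) by rewrite /D mulrAC; exact: lu.
have bl : bd l (D + r).
  rewrite -(subrK (u 0) l); apply: (bdD cn) (bdu 0).
  by have := lu' 0; rewrite expr0 mulr1.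
have {}lE : l = hf * (x + l * l).
  apply/eqP; rewrite -subr_eq0; apply/eqP/(bd_eq0 cn) => e e0.
  (* l minus the right-hand side is at most C r^n for every n: compare both with u n. *)
  pose C := D + 2^-1 * (r * D + D * (D + r)).
  have C0 : 0 <= C.
    by rewrite addr_ge0// mulr_ge0 ?invr_ge0// addr_ge0// mulr_ge0// addr_ge0.
  have C1 : 0 < C + 1 by rewrite ltr_wpDl.
  have [n rn] := expr_small r01 (divr_gt0 e0 C1).
  have -> : l - hf * (x + l * l) = (l - u n.+1) +
      hf * (u n * (u n - l) + (u n - l) * l).
    by rewrite -mul_subK -(subrKA (u n.+1)) -mulrBr opprD addrACA subrr add0r.
  have := bdN cn (lu' n); rewrite opprB => nl.
  have b2 := bdM cn (bd_half cn) (bdD cn (bdM cn (bdu n) nl) (bdM cn nl bl)).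
  apply: (bd_le cn (bdD cn (lu' n.+1) b2)).
  have rn0 : 0 <= r ^+ n by exact: exprn_ge0.
  apply: (@le_trans _ _ ((C + 1) * r ^+ n)).
    have -> : 2^-1 * (r * (D * r ^+ n) + D * r ^+ n * (D + r)) =
      2^-1 * (r * D + D * (D + r)) * r ^+ n by ring.
    rewrite exprS mulrDl mul1r {1}/C mulrDl -addrA lerD//.
      by rewrite ler_wpM2l// ler_piMl// ltW.
    by rewrite lerDl.
  by rewrite mulrC -ler_pdivlMr// ltW.
have lD : l + l = x + l * l by rewrite {1 2}lE -mulrDl (halfD cn) mul1r.
have lB : l - l * l = x - l.
  by apply/eqP; rewrite subr_eq addrAC -lD addrK.
by rewrite mulrBl mul1r mulrBr mulr1 lB opprB addrA subrK.
Qed.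

End SquareRoot.

(** * Commutative C*-algebras *)

Section CommutativeCStar.
Variables (R : realType) (A : cstarType R).

Lemma star_mul (a b : A) : star (a * b) = star b * star a.
Proof. exact: starM. Qed.

Lemma norm_mul_le (a b : A) : `|a * b| <= `|a| * `|b|.
Proof. exact: norm_cmul. Qed.

Lemma norm_star_mul (a : A) : `|star a * a| = `|a| ^+ 2.
Proof. exact: norm_star_cmul. Qed.

Lemma star_is_one : star (1 : A) = 1.
Proof.
have := star_mul (star 1 : A) 1; rewrite mulr1 starK mulr1.
by move<-.
Qed.

Lemma starN (a : A) : star (- a) = - star a.
Proof. by rewrite -scaleN1r starZ rmorphN1 scaleN1r. Qed.

Lemma starB (a b : A) : star (a - b) = star a - star b.
Proof. by rewrite starD starN. Qed.

Lemma norm_star (a : A) : `|star a| = `|a|.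
Proof.
suff le (b : A) : `|b| <= `|star b|.
  by apply/eqP; rewrite eq_le le andbT; have := le (star a); rewrite starK.
have [->|b0] := eqVneq b 0; first by rewrite normr0.
have := norm_mul_le (star b) b; rewrite norm_star_mul expr2 ler_pM2r//.
by rewrite normr_gt0.
Qed.

Lemma norm_one : `|1 : A| = 1.
Proof.
have := norm_star_mul (1 : A); rewrite star_is_one mulr1 expr2.
rewrite -[X in X = _ -> _]mul1r => /esym/mulIf; apply.
by rewrite normr_eq0 oner_eq0.
Qed.

Lemma cstar_complete : complete_normed (fun (a : A) m => `|a| <= m%:C%C)
  (fun a => star a = a) (2^-1 *: 1).
Proof.
split.
- by rewrite normr0.
- by move=> a m n am mn; apply: le_trans am _; rewrite lecR.
- by move=> a b m n am bn; rewrite (le_trans (ler_normD _ _))// rmorphD lerD.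
- by move=> a m; rewrite normrN.
- by move=> a b m n am bn; rewrite (le_trans (norm_mul_le _ _))// rmorphM ler_pM.
- move=> a ae; apply/eqP; rewrite -normr_le0; apply/ler_addgt0Pr => e e0.
  have /complex_realP[d eE] : e \is Num.real by rewrite gtr0_real.
  by rewrite {}eE (ltcR 0) in e0 *; rewrite add0r; exact: ae.
- by rewrite normrZ norm_one mulr1 normfV normr_nat fmorphV rmorph_nat.
- by rewrite -scalerDl -[X in X + X]mul1r -splitr scale1r.
- exact: star_is_one.
- by move=> a b aE bE; rewrite starB aE bE.
- by move=> a aE; rewrite star_mul aE.
- move=> a aE; rewrite -scalerAl mul1r starZ aE; congr (_ *: _).
  by rewrite geC0_conj// invr_ge0 ler0n.
- move=> u r D r01 D0 uD su; have [l lu] := geometric_limit r01 D0 uD.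
  exists l => //; apply/eqP; rewrite -subr_eq0; apply/eqP.
  have r1' : 0 < 1 - r by rewrite subr_gt0; case/andP: r01.
  apply: (@geometric_eq0 _ _ _ r (D / (1 - r) + D / (1 - r))) => // [|n].
    by rewrite addr_ge0// divr_ge0// ltW.
  rewrite -(subrKA (u n)) (le_trans (ler_normD _ _))// -{1}(su n) -starB norm_star.
  rewrite [X in _ + X]distrC mulrDl rmorphD mulrAC lerD//; exact: lu.
Qed.

Hypothesis comA : commutative (@GRing.mul A).

(** A with its commutative ring structure, which depends on the proof comA and
therefore cannot be a canonical structure on A. *)
Definition com_ring : comNzRingType :=
  HB.pack (CStarAlgebra.sort A) (GRing.PzRing_hasCommutativeMul.Build A comA).

Definition com_scalar : {rmorphism R[i] -> com_ring} := GRing.in_alg A.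

Lemma star_zmod : zmod_morphism (star : com_ring -> com_ring).
Proof. exact: starB. Qed.

Lemma star_monoid : monoid_morphism (star : com_ring -> com_ring).
Proof. by split; [exact: star_is_one|move=> a b; rewrite star_mul; exact: comA]. Qed.

Definition com_star : {rmorphism com_ring -> com_ring} :=
  HB.pack (star : com_ring -> com_ring)
    (GRing.isZmodMorphism.Build _ _ _ star_zmod)
    (GRing.isMonoidMorphism.Build _ _ _ star_monoid).

Lemma com_starK : involutive com_star.
Proof. exact: starK. Qed.

Lemma com_star_scalar z : com_star (com_scalar z) = com_scalar z^*.
Proof. by rewrite /= starZ star_is_one. Qed.

(** If N exceeds twice the norm of star(a) a, then 1 - star(a) a / N is the square of
a self-adjoint element. *)
Lemma cstar_arch (a : com_ring) :
  exists2 K, 0 <= K & psd com_star (com_scalar K - com_star a * a).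
Proof.
pose x : A := star a * a; pose N := `|x| + `|x| + 1.
have N0 : 0 < N by rewrite ltr_wpDl// addr_ge0.
have sx : star x = x by rewrite star_mul starK.
have r01 : 0 <= (2^-1 : R) < 1 by rewrite invr_ge0 ler0n invf_lt1 ?ltr1n ?ltr0n.
have sNx : star (N^-1 *: x) = N^-1 *: x.
  by rewrite starZ sx; congr (_ *: _); rewrite geC0_conj// invr_ge0 ltW.
have bNx : `|N^-1 *: x| <= (2^-1 : R)%:C%C.
  rewrite normrZ gtr0_norm ?invr_gt0// fmorphV rmorph_nat mulrC ler_pdivrMr//.
  rewrite ler_pdivlMl ?ltr0n// mulr_natl mulr2n /N lerDl ler01//.
have [y sy yE] := sqrt_one_minus cstar_complete r01 sNx bNx.
exists N; first exact: ltW.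
have -> : com_scalar N - com_star a * a = com_scalar N * (com_star y * y).
  change (N%:A - x = N%:A * (star y * y)).
  by rewrite sy yE mulr_algl scalerBr scalerA mulfV ?scale1r// gt_eqF.
by apply: psdM; [apply: (psd_k com_star_scalar); exact: ltW|exact: psd_sq].
Qed.

End CommutativeCStar.

(** * Operators on a Hilbert space *)

Section HilbertSpace.
Variables (R : realType) (H : hilbertType R).
Implicit Types x y z : H.

(** The norm takes its values in R[i]; real arithmetic needs it in R. *)
Definition rnorm x : R := complex.Re `|x|.

Lemma rnormE x : (rnorm x)%:C%C = `|x|.
Proof. by rewrite /rnorm RRe_real// ger0_real. Qed.

Lemma rnorm_ge0 x : 0 <= rnorm x.
Proof. rewrite -(lecR 0) rnormE; exact: normr_ge0. Qed.

Lemma inner_conj x y : inner x y = (inner y x)^*.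
Proof. by rewrite hermC expr0 mul1r. Qed.

Lemma inner_ge0 x : 0 <= inner x x.
Proof. exact: dnorm_ge0. Qed.

Lemma innerDl x y z : inner (x + y) z = inner x z + inner y z.
Proof. exact: linearDl. Qed.
Lemma innerBl x y z : inner (x - y) z = inner x z - inner y z.
Proof. exact: linearBl. Qed.
Lemma innerZl a x z : inner (a *: x) z = a * inner x z.
Proof. exact: linearZl_LR. Qed.
Lemma innerDr x y z : inner z (x + y) = inner z x + inner z y.
Proof. exact: linearDr. Qed.
Lemma innerBr x y z : inner z (x - y) = inner z x - inner z y.
Proof. exact: linearBr. Qed.
Lemma innerZr a x z : inner z (a *: x) = a^* * inner z x.
Proof. exact: linearZr_LR. Qed.
Lemma inner0l z : inner 0 z = 0.
Proof. exact: linear0l. Qed.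
Lemma inner0r z : inner z 0 = 0.
Proof. exact: linear0r. Qed.
Lemma inner_suml (I : Type) (r : seq I) (P : pred I) (F : I -> H) z :
  inner (\sum_(i <- r | P i) F i) z = \sum_(i <- r | P i) inner (F i) z.
Proof. exact: (big_morph (inner^~ z) (fun x y => innerDl x y z) (inner0l z)). Qed.
Lemma inner_sumr (I : Type) (r : seq I) (P : pred I) (F : I -> H) z :
  inner z (\sum_(i <- r | P i) F i) = \sum_(i <- r | P i) inner z (F i).
Proof. exact: (big_morph (inner z) (fun x y => innerDr x y z) (inner0r z)). Qed.

Lemma inner_eq0 x : inner x x = 0 -> x = 0.
Proof. by move=> /eqP; rewrite dnorm_eq0 => /eqP. Qed.

Lemma inner_inj x y : (forall z, inner z x = inner z y) -> x = y.
Proof.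
by move=> xy; apply/subr0_eq/inner_eq0; rewrite innerBr xy subrr.
Qed.

Lemma cauchy_schwarz x y : `|inner x y| <= `|x| * `|y|.
Proof.
have [->|y0] := eqVneq y 0; first by rewrite inner0r !normr0 mulr0.
have yy0 : 0 < inner y y by rewrite dnorm_gt0.
rewrite -(@ler_pXn2r _ 2) ?nnegrE ?mulr_ge0// exprMn !sqr_norm_inner.
rewrite -ler_pdivrMr// -subr_ge0.
have := inner_ge0 (x - (inner x y / inner y y) *: y).
rewrite innerBl !innerBr !innerZl !innerZr fmorph_div/= -!inner_conj normCK.
by rewrite -inner_conj; congr (0 <= _); field; rewrite gt_eqF.
Qed.

Notation BH := (bounded_op H).
Implicit Types S T : BH.

Lemma add_opE S T x : (S + T) x = S x + T x.
Proof. by []. Qed.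
Lemma opp_opE S x : (- S) x = - S x.
Proof. by []. Qed.
Lemma sub_opE S T x : (S - T) x = S x - T x.
Proof. by []. Qed.
Lemma mul_opE S T x : (S * T) x = S (T x).
Proof. by []. Qed.
Lemma scale_opE a S x : (a *: S) x = a *: S x.
Proof. by []. Qed.
Lemma one_opE x : (1 : BH) x = x.
Proof. by []. Qed.
Lemma zero_opE x : (0 : BH) x = 0.
Proof. by []. Qed.
Lemma sum_opE (I : Type) (r : seq I) (P : pred I) (F : I -> BH) x :
  (\sum_(i <- r | P i) F i) x = \sum_(i <- r | P i) F i x.
Proof.
exact: (big_morph (fun S : BH => S x) (fun S T => add_opE S T x) (zero_opE x)).
Qed.

Lemma opD S x y : S (x + y) = S x + S y.
Proof. exact: linearD. Qed.
Lemma opB S x y : S (x - y) = S x - S y.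
Proof. exact: linearB. Qed.
Lemma opZ S a x : S (a *: x) = a *: S x.
Proof. exact: linearZ. Qed.

Definition op_le S m := 0 <= m /\ forall x, `|S x| <= m%:C%C * `|x|.

Definition symmetric_op S := forall x y, inner (S x) y = inner x (S y).

Lemma op_leP S : exists m, op_le S m.
Proof.
have [_ [M SM]] := bounded_opP S.
exists (complex.Re `|M|); have Mr : (complex.Re `|M|)%:C%C = `|M|.
  by rewrite RRe_real// ger0_real.
split; first by rewrite -(lecR 0) Mr; exact: normr_ge0.
move=> x; rewrite Mr; have [->|x0] := eqVneq x 0.
  by rewrite linear0 !normr0 mulr0.
have M0 : 0 <= M.
  by have := le_trans (normr_ge0 _) (SM x); rewrite pmulr_lge0// normr_gt0.
by rewrite ger0_norm.
Qed.

Lemma adjoint_unique S T :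
  (forall x y, inner (T x) y = inner x (S y)) -> adjoint T = S.
Proof.
move=> TS; apply: bounded_op_ext => y; apply: inner_inj => x.
pose adj := [set S0 : BH | forall x0 y0, inner (T x0) y0 = inner x0 (S0 y0)].
have /= <- := @xgetPex _ 0 adj _ x y.
  by rewrite TS.
by exists S.
Qed.

Definition half_op : BH := (2^-1 : R[i]) *: (1 : BH).

Lemma bounded_op_complete : complete_normed op_le symmetric_op half_op.
Proof.
split.
- by split=> // x; rewrite zero_opE normr0 mul0r.
- move=> S m n [m0 Sm] mn; split; first exact: le_trans mn.
  by move=> x; rewrite (le_trans (Sm x))// ler_wpM2r// lecR.
- move=> S T m n [m0 Sm] [n0 Tn]; split; first exact: addr_ge0.
  move=> x; rewrite add_opE (le_trans (ler_normD _ _))// rmorphD/= mulrDl.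
  by rewrite lerD.
- by move=> S m [m0 Sm]; split=> // x; rewrite opp_opE normrN.
- move=> S T m n [m0 Sm] [n0 Tn]; split; first exact: mulr_ge0.
  move=> x; rewrite mul_opE (le_trans (Sm _))// rmorphM/= -mulrA.
  by rewrite ler_wpM2l// (ler0c m).
- move=> S Se; apply: bounded_op_ext => x.
  apply: (@geometric_eq0 _ _ _ 2^-1 (rnorm x)) => [||n].
  + by rewrite invr_ge0 ler0n invf_lt1 ?ltr1n ?ltr0n.
  + exact: rnorm_ge0.
  + have h0 : 0 < (2^-1 : R) by rewrite invr_gt0 ltr0n.
    have [_ Sn] := Se _ (exprn_gt0 n h0).
    by rewrite rmorphM/= rnormE mulrC; exact: Sn.
- split=> [|x]; first by rewrite invr_ge0 ler0n.
  by rewrite scale_opE one_opE normrZ normfV normr_nat fmorphV rmorph_nat.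
- by rewrite -scalerDl -[X in X + X]mul1r -splitr scale1r.
- by [].
- by move=> S T sS sT x y; rewrite !sub_opE innerBl innerBr sS sT.
- by move=> S sS x y; rewrite !mul_opE !sS.
- move=> S sS x y; rewrite !mul_opE !scale_opE !one_opE innerZl innerZr sS.
  by rewrite geC0_conj// invr_ge0 ler0n.
move=> u r D r01 D0 uD su.
have r1' : 0 < 1 - r by rewrite subr_gt0; case/andP: r01.
have DrE z n : (D * rnorm z * r ^+ n / (1 - r))%:C%C =
    (D / (1 - r) * r ^+ n)%:C%C * `|z|.
  by rewrite -rnormE -rmorphM/=; congr (_%:C%C); ring.
have [l lu] : exists l : H -> H, forall x n,
    `|l x - u n x| <= (D / (1 - r) * r ^+ n)%:C%C * `|x|.
  suff /choice[l lu] : forall x, exists z, forall n,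
      `|z - u n x| <= (D / (1 - r) * r ^+ n)%:C%C * `|x| by exists l.
  move=> x; have [||n|z zu] := @geometric_limit _ _ (fun n => u n x) r (D * rnorm x).
  - exact: r01.
  - by rewrite mulr_ge0// rnorm_ge0.
  - have [_ /(_ x)] := uD n; rewrite sub_opE -(rnormE x) -rmorphM/=.
    by rewrite mulrAC.
  - by exists z => n; rewrite -DrE; exact: zu.
pose C := D / (1 - r); have C0 : 0 <= C by rewrite divr_ge0// ltW.
have llin : linear l.
  move=> a x y; apply/subr0_eq.
  apply: (@geometric_eq0 _ _ _ r
    (C * (rnorm (a *: x + y) + rnorm (a *: x) + rnorm y))) => // [|n].
    by rewrite mulr_ge0// !addr_ge0 ?rnorm_ge0.
  have -> : l (a *: x + y) - (a *: l x + l y) =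
      (l (a *: x + y) - u n (a *: x + y)) - a *: (l x - u n x) - (l y - u n y).
    have -> : u n (a *: x + y) = a *: u n x + u n y by rewrite linearP.
    rewrite scalerBr -[RHS]addrA -[X in _ = _ + X]opprD.
    by rewrite [X in _ = _ - X]addrACA -[X in _ + _ + X]opprD opprB addrA subrK.
  apply: le_trans (ler_normB _ _) _; apply: le_trans (lerD (ler_normB _ _) (lexx _)) _.
  rewrite normrZ mulrAC rmorphM/= !rmorphD/= !rnormE normrZ !mulrDr.
  by rewrite !lerD// mulrCA ler_wpM2l.
have [m [m0 um]] := op_leP (u 0).
have lbd x : `|l x| <= (C + m)%:C%C * `|x|.
  rewrite -(subrK (u 0 x) (l x)) (le_trans (ler_normD _ _))// rmorphD mulrDl.
  by apply: lerD (um x); have := lu x 0; rewrite expr0 mulr1.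
have bl : l \in @bounded_linear_pred R H.
  by apply/asboolP; split=> //; exists (C + m)%:C%C.
exists (BoundedOp bl) => [x y|n]; last first.
  have /andP[r0 _] := r01.
  split=> [|x]; first by rewrite divr_ge0 ?mulr_ge0 ?exprn_ge0// ltW.
  by rewrite mulrAC sub_opE.
apply/subr0_eq.
apply: (@geometric_eq0 _ _ _ r (C * (rnorm x * rnorm y *+ 2))) => // [|n].
  by rewrite mulr_ge0// mulrn_wge0// mulr_ge0 ?rnorm_ge0.
have -> : inner (BoundedOp bl x) y - inner x (BoundedOp bl y) =
   inner (l x - u n x) y - inner x (l y - u n y).
  by rewrite innerBl innerBr su opprB addrA subrK.
apply: le_trans (ler_normB _ _) _.
apply: le_trans (lerD (cauchy_schwarz _ _) (cauchy_schwarz _ _)) _.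
rewrite mulrAC mulr2n mulrDr rmorphD !rmorphM/= !rnormE; apply: lerD.
  rewrite mulrA; apply: ler_wpM2r => //; rewrite -!rmorphM/=; exact: lu.
rewrite mulrCA; apply: ler_wpM2l => //; rewrite -!rmorphM/=; exact: lu.
Qed.

Definition positive_op S := forall x, 0 <= inner (S x) x.

(** The polarization argument: a sesquilinear form with real quadratic form is
hermitian. The hypotheses are that form at x + y and at x + i y. *)
Lemma conj_of_real_polar (z w : R[i]) :
  z + w \is Num.real -> 'i * (w - z) \is Num.real -> z = w^*.
Proof.
rewrite !CrealE rmorphD rmorphM rmorphB/= conjCi => /eqP h1 /eqP h2.
have {}h2 : z^* - w^* = w - z.
  apply: (mulfI (neq0Ci R[i])); rewrite -h2; ring.
have : z + z = w^* + w^*.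
  by transitivity ((z + w) - (w - z)); [ring|rewrite -h1 -h2; ring].
have half (u : R[i]) : u = 2^-1 * (u + u) by field.
by move=> e; rewrite (half z) e -half.
Qed.

Lemma positive_symmetric S : positive_op S -> symmetric_op S.
Proof.
move=> S0 x y; rewrite [RHS]inner_conj; apply: conj_of_real_polar.
  have -> : inner (S x) y + inner (S y) x =
    inner (S (x + y)) (x + y) - inner (S x) x - inner (S y) y.
    by rewrite opD innerDl !innerDr; ring.
  by rewrite !rpredB// ger0_real.
have -> : 'i * (inner (S y) x - inner (S x) y) =
    inner (S (x + 'i *: y)) (x + 'i *: y) - inner (S x) x - inner (S y) y.
  rewrite opD opZ innerDl !innerDr !innerZl !innerZr conjCi.
  have -> : 'i * (- 'i * inner (S y) y) = - ('i ^+ 2) * inner (S y) y by ring.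
  by rewrite sqrCi; ring.
by rewrite !rpredB// ger0_real.
Qed.

(** Positivity of S at x - S x / r gives |S x|^2 <= r <S x, x>, once <S (S x), S x>
is bounded by r |S x|^2. *)
Lemma op_le_of_quadratic S (r : R) : 0 < r -> positive_op S ->
  (forall x, inner (S x) x <= r%:C%C * inner x x) -> op_le S r.
Proof.
move=> r0 S0 Sr; split; first exact: ltW.
have rC : 0 < r%:C%C by rewrite (ltcR 0).
have rC0 := ltW rC.
move=> x; rewrite -(@ler_pXn2r _ 2) ?nnegrE ?mulr_ge0// exprMn !sqr_norm_inner.
have sS := positive_symmetric S0; set k := S x.
have := S0 (x - r%:C%C^-1 *: k); rewrite opB opZ -/k.
have rVc : (r%:C%C^-1)^* = r%:C%C^-1 by rewrite geC0_conj// invr_ge0 ltW.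
rewrite innerBl !innerBr !innerZl !innerZr rVc.
have -> : inner (S k) x = inner k k by rewrite sS.
move=> h; have {}h : inner k k <= r%:C%C * inner k x.
  rewrite -subr_ge0; apply: le_trans (mulr_ge0 (ltW rC) h) _.
  have -> : r%:C%C * (inner k x - r%:C%C^-1 * inner k k -
    (r%:C%C^-1 * inner k k - r%:C%C^-1 * (r%:C%C^-1 * inner (S k) k))) =
    r%:C%C * inner k x - inner k k - (inner k k - r%:C%C^-1 * inner (S k) k).
    by field; rewrite gt_eqF.
  by rewrite gerBl subr_ge0 ler_pdivrMl.
by apply: le_trans h _; rewrite expr2 -mulrA ler_wpM2l ?Sr.
Qed.

Lemma sqrt_op S (c : R[i]) : 0 < c < 1 -> (forall x, c * inner x x <= inner (S x) x) ->
  (forall x, inner (S x) x <= inner x x) ->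
  exists2 T, adjoint T = T & T * T = S.
Proof.
move=> /andP[c0 c1] cS S1.
have /complex_realP[r rE] : 1 - c \is Num.real by rewrite gtr0_real// subr_gt0.
have r01 : 0 < r < 1.
  by rewrite -(ltcR 0) -(ltcR r 1) -rE subr_gt0 c1/= gtrDl oppr_lt0.
have /andP[r0 r1] := r01.
have pK : positive_op (1 - S).
  by move=> x; rewrite sub_opE one_opE innerBl subr_ge0.
have Kr x : inner ((1 - S) x) x <= r%:C%C * inner x x.
  by rewrite sub_opE one_opE innerBl -rE mulrBl mul1r lerB.
have r01' : 0 <= r < 1 by rewrite ltW.
have [T sT TT] := sqrt_one_minus bounded_op_complete r01' (positive_symmetric pK)
  (op_le_of_quadratic r0 pK Kr).
exists T; first exact: adjoint_unique.
by rewrite TT opprB addrC subrK.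
Qed.

Lemma ReD (z w : R[i]) : complex.Re (z + w) = complex.Re z + complex.Re w.
Proof. by case: z; case: w. Qed.
Lemma ReN (z : R[i]) : complex.Re (- z) = - complex.Re z.
Proof. by case: z. Qed.
Lemma ReZ (r : R) (z : R[i]) : complex.Re (r%:C%C * z) = r * complex.Re z.
Proof. by case: z => a b /=; rewrite mul0r subr0. Qed.

Lemma Re_norm (z : R[i]) : (`|complex.Re z|)%:C%C <= `|z|.
Proof.
case: z => a b; rewrite normc_def/= lecR -sqrtr_sqr ler_sqrt ?addr_ge0 ?sqr_ge0//.
by rewrite lerDl sqr_ge0.
Qed.

(** Minimize J x = |x|^2 - 2 Re (f x), which is bounded below. By the parallelogram
law a minimizing sequence converges geometrically when its values do, and the
first-order condition at the limit v is Re <x, v> = Re (f x) for all x; applied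
to i x it gives the imaginary parts. *)
Lemma riesz (f : H -> R[i]) (M : R) : scalar f -> 0 <= M ->
  (forall x, `|f x| <= M%:C%C * `|x|) -> exists v, forall x, f x = inner x v.
Proof.
move=> fl M0 fM.
have fD x y : f (x + y) = f x + f y by rewrite -[x]scale1r fl mul1r scale1r.
have f0 : f 0 = 0 by apply: (addrI (f 0)); rewrite -fD !addr0.
have fZ a x : f (a *: x) = a * f x by rewrite -[_ *: _]addr0 fl f0 addr0.
pose g x := complex.Re (f x); pose ip x y := complex.Re (inner x y).
have gD x y : g (x + y) = g x + g y by rewrite /g fD ReD.
have gZ (a : R) x : g (a%:C%C *: x) = a * g x by rewrite /g fZ ReZ.
have ipZ (a : R) x y : ip (a%:C%C *: x) y = a * ip x y by rewrite /ip innerZl ReZ.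
have ipBr x y z : ip x (y - z) = ip x y - ip x z by rewrite /ip innerBr ReD ReN.
have ipnorm x y : `|ip x y| <= rnorm x * rnorm y.
  by rewrite -lecR rmorphM/= !rnormE (le_trans (Re_norm _))// cauchy_schwarz.
have rnD x y : rnorm (x + y) ^+ 2 = rnorm x ^+ 2 + 2 * ip x y + rnorm y ^+ 2.
  have E z : rnorm z ^+ 2 = ip z z.
    by rewrite /ip -sqr_norm_inner -rnormE -rmorphXn.
  rewrite !E /ip innerDl !innerDr !ReD.
  have -> : complex.Re (inner y x) = complex.Re (inner x y).
    by rewrite [inner y x]inner_conj; case: (inner x y).
  ring.
have rnB x y : rnorm (x - y) ^+ 2 = rnorm x ^+ 2 - 2 * ip x y + rnorm y ^+ 2.
  rewrite rnD; congr (_ + _ + _); last by rewrite /rnorm normrN.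
  by rewrite /ip -scaleN1r innerZr rmorphN1 mulN1r ReN mulrN.
pose J x := rnorm x ^+ 2 - 2 * g x.
have gM x : `|g x| <= M * rnorm x.
  by rewrite -lecR rmorphM/= rnormE (le_trans (Re_norm _)).
have JM x : - M ^+ 2 <= J x.
  have := gM x; rewrite ler_norml => /andP[_ gx].
  rewrite /J; have := sqr_ge0 (rnorm x - M); nra.
have hJ : has_inf [set J x | x in setT].
  by split; [exists (J 0), 0|exists (- M ^+ 2) => _ [x _ <-]].
pose I := inf [set J x | x in setT].
have IJ x : I <= J x by apply: ge_inf; [case: hJ|exists x].
pose h : R := 2^-1.
have h01 : 0 <= h < 1 by rewrite /h invr_ge0 ler0n invf_lt1 ?ltr1n ?ltr0n.
have h0 : 0 < h by rewrite invr_gt0 ltr0n.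
have [u uJ] : exists u : nat -> H, forall n, J (u n) < I + (h ^+ n) ^+ 2.
  suff /choice[u] : forall n, exists x, J x < I + (h ^+ n) ^+ 2 by exists u.
  move=> n; have [_ [x _ <-] xI] := inf_adherent (exprn_gt0 2 (exprn_gt0 n h0)) hJ.
  by exists x.
have uC n : `|u n.+1 - u n| <= (2 * h ^+ n)%:C%C.
  rewrite -rnormE lecR -(@ler_pXn2r _ 2) ?nnegrE ?rnorm_ge0 ?mulr_ge0 ?exprn_ge0 ?ltW//.
  have := uJ n; have := uJ n.+1; have := IJ (h%:C%C *: (u n.+1 + u n)).
  rewrite /J gZ gD.
  have -> : rnorm (h%:C%C *: (u n.+1 + u n)) ^+ 2 = h ^+ 2 * rnorm (u n.+1 + u n) ^+ 2.
    rewrite -exprMn; congr (_ ^+ 2).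
    by rewrite /rnorm normrZ ger0_norm ?(ler0c h) ?ltW// ReZ.
  rewrite rnB rnD (exprS h n) (exprMn _ 2 (h ^+ n)) (exprMn _ h (h ^+ n)).
  set a := g _; set b := g _; set c := ip _ _; set p := rnorm _; set q := rnorm _.
  have hh : h ^+ 2 = 4^-1 by rewrite /h; field.
  have := sqr_ge0 (h ^+ n); rewrite hh /h.
  set t := (2^-1 ^+ n) ^+ 2; set p2 := p ^+ 2; set q2 := q ^+ 2 => *; lra.
have [v uv] := geometric_limit h01 (ler0n _ 2) uC.
exists v.
(* The condition at u n, namely J (u n + x) >= J (u n) - h^(2n), transferred to v. *)
have near n x : - (1 + 8 * rnorm x) * h ^+ n <= 2 * (ip x v - g x) + rnorm x ^+ 2.
  have := IJ (u n + x); have := uJ n; rewrite /J gD rnD.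
  have := ipnorm x (v - u n); rewrite ipBr.
  have vu : rnorm (v - u n) <= 4 * h ^+ n.
    rewrite -lecR rnormE; apply: le_trans (uv n) _; rewrite lecR le_eqVlt.
    by apply/orP; left; apply/eqP; rewrite /h; field.
  have := ler_wpM2l (rnorm_ge0 x) vu.
  have hn1 : h ^+ n <= 1 by rewrite exprn_ile1// ?ltW//; case/andP: h01.
  have hn0 : 0 <= h ^+ n by rewrite exprn_ge0// ltW.
  have := ler_wpM2r hn0 hn1; rewrite mul1r -expr2 ler_norml.
  have : ip (u n) x = ip x (u n).
    by rewrite /ip [inner x _]inner_conj; case: (inner _ _).
  move=> -> ? ? /andP[? ?] ? ?; lra.
have lim x : 0 <= 2 * (ip x v - g x) + rnorm x ^+ 2.
  rewrite leNgt; apply/negP => neg.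
  have c0 : 0 < 1 + 8 * rnorm x by rewrite ltr_wpDr// mulr_ge0// rnorm_ge0.
  rewrite -oppr_gt0 in neg; have [n] := expr_small h01 (divr_gt0 neg c0).
  rewrite ltr_pdivlMr// => hn; have := near n x; lra.
(* Divide the condition at t x by t and let t tend to 0; t is chosen so that the
quadratic term cannot compensate a negative linear one. *)
have ge x : 0 <= ip x v - g x.
  rewrite leNgt; apply/negP; set a := ip x v - g x => a0.
  pose b := rnorm x ^+ 2; have b0 : 0 <= b by exact: sqr_ge0.
  pose t := - a / (b + 1); have b1 : 0 < b + 1 by rewrite ltr_wpDl.
  have t0 : 0 < t by rewrite divr_gt0// oppr_gt0.
  have tb : t * (b + 1) = - a by rewrite /t divfK// gt_eqF.
  have := lim (t%:C%C *: x); rewrite ipZ gZ -mulrBr -/a.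
  have -> : rnorm (t%:C%C *: x) ^+ 2 = t ^+ 2 * b.
    rewrite -exprMn; congr (_ ^+ 2).
    by rewrite /rnorm normrZ ger0_norm ?(ler0c t) ?ltW// ReZ.
  nra.
have eqRe x : ip x v = g x.
  have gN : g (- x) = - g x.
    by apply/eqP; rewrite -addr_eq0 -gD addNr /g f0.
  have := ge x; have := ge (- x); rewrite gN.
  have -> : ip (- x) v = - ip x v.
    by rewrite /ip -scaleN1r innerZl mulN1r ReN.
  by move=> ? ?; apply/eqP; rewrite eq_le; apply/andP; split; lra.
move=> x; have := eqRe ('i%C *: x); have := eqRe x.
rewrite /ip /g innerZl fZ [_ * inner x v]mulrC [_ * f x]mulrC !ReiNIm.
by case: (inner x v) => a b; case: (f x) => c d /= -> /oppr_inj ->.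
Qed.

(** The adjoint is a chosen operator with this property; the Riesz theorem gives one. *)
Lemma adjointP S x y : inner (S x) y = inner x (adjoint S y).
Proof.
have [m [m0 Sm]] := op_leP S.
suff [T TP] : exists T : BH, forall x y, inner (S x) y = inner x (T y).
  by rewrite (adjoint_unique TP) TP.
have /choice[T TP] : forall y, exists v, forall x, inner (S x) y = inner x v.
  move=> {}y; apply: (@riesz (fun x => inner (S x) y) (m * rnorm y)).
  - by move=> a u v; rewrite opD opZ innerDl innerZl.
  - by rewrite mulr_ge0// rnorm_ge0.
  move=> {}x; rewrite rmorphM/= rnormE mulrAC.
  by rewrite (le_trans (cauchy_schwarz _ _))// ler_wpM2r.
have bT : T \in @bounded_linear_pred R H.
  apply/asboolP; split.
    move=> a u v; apply: inner_inj => z.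
    by rewrite -TP !innerDr !innerZr !TP.
  exists m%:C%C => v; have [->|Tv0] := eqVneq (T v) 0.
    by rewrite normr0 mulr_ge0// (ler0c m).
  rewrite -(@ler_pM2r _ `|T v|) ?normr_gt0// -expr2 sqr_norm_inner -TP.
  rewrite -[leLHS]ger0_norm; last by rewrite TP inner_ge0.
  by rewrite (le_trans (cauchy_schwarz _ _))// mulrAC ler_wpM2r.
by exists (BoundedOp bT).
Qed.

End HilbertSpace.

(** * Completely positive maps on a commutative C*-algebra *)

Section UCPMaps.
Variables (R : realType) (A : cstarType R) (H : hilbertType R).
Hypothesis comA : commutative (@GRing.mul A).
Notation BH := (bounded_op H).
Notation B := (com_ring comA).
Notation st := (com_star comA).
Notation k := (com_scalar comA).
Implicit Types (phi psi : A -> BH) (x y : H).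

Lemma linear_addP phi : linear phi -> forall a b, phi (a + b) = phi a + phi b.
Proof. by move=> lphi a b; rewrite -[a]scale1r lphi !scale1r. Qed.

Lemma linear_scaleP phi : linear phi -> forall c a, phi (c *: a) = c *: phi a.
Proof.
move=> lphi c a; have phi0 : phi 0 = 0.
  by apply: (addrI (phi 0)); rewrite -linear_addP// !addr0.
by rewrite -[c *: a]addr0 lphi phi0 addr0.
Qed.

Lemma linear_zeroP phi : linear phi -> phi 0 = 0.
Proof. by move=> lphi; rewrite -(scale0r (0 : A)) linear_scaleP// scale0r. Qed.

Lemma linear_subP phi : linear phi -> forall a b, phi (a - b) = phi a - phi b.
Proof.
by move=> lphi a b; rewrite linear_addP// -scaleN1r linear_scaleP// scaleN1r.
Qed.

Lemma linear_sumP phi : linear phi ->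
  forall (I : Type) (r : seq I) (P : pred I) (F : I -> A),
  phi (\sum_(i <- r | P i) F i) = \sum_(i <- r | P i) phi (F i).
Proof.
by move=> lphi I r P F; apply: (big_morph phi (linear_addP lphi) (linear_zeroP lphi)).
Qed.

Lemma scalar_mul c (a : B) : k c * a = (c *: (a : A)).
Proof. exact: mulr_algl. Qed.

(** Positivity of phi at the hermitian square of Y, where Y is the 2 x 2
matrix with first row (b, b g) and second row zero. *)
Lemma ucp_block_sq phi (b g : A) x y : ucp_map phi ->
  0 <= inner (phi (star b * b) y) y + inner (phi (star b * (b * g)) x) y
     + inner (phi (star (b * g) * b) y) x + inner (phi (star (b * g) * (b * g)) x) x.
Proof.
move=> [lphi _ cphi].
pose Y : 'M[A]_2 := \matrix_(i, j)
  if i == ord0 then (if j == ord0 then b else b * g) else 0.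
pose v (i : 'I_2) := if i == ord0 then y else x.
have := cphi _ _ (ex_intro _ Y erefl) v.
rewrite !big_ord_recl !big_ord0 !mxE !big_ord_recl !big_ord0 !mxE /v /= !addr0.
by rewrite !mulr0 !addr0 !addrA.
Qed.

Lemma ucp_block phi (e g : B) x y : ucp_map phi -> psd st e ->
  0 <= inner (phi e y) y + inner (phi (e * g) x) y
     + inner (phi (e * st g) y) x + inner (phi (e * (st g * g)) x) x.
Proof.
move=> uphi; have [lphi _ _] := uphi.
elim=> [|b p _ IH].
  by rewrite !mul0r (linear_zeroP lphi) zero_opE !inner0l !addr0.
have := addr_ge0 (ucp_block_sq b g x y uphi) IH.
rewrite !mulrDl !(linear_addP lphi) !add_opE !innerDl.
have -> : star b * (b * g) = st b * b * g :> B by rewrite mulrA.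
have -> : star (b * g) * b = st b * b * st g :> B.
  change (st (b * g) * b = st b * b * st g); rewrite rmorphM; ring.
have -> : star (b * g) * (b * g) = st b * b * (st g * g) :> B.
  change (st (b * g) * (b * g) = st b * b * (st g * g)); rewrite rmorphM; ring.
have -> : star b * b = st b * b :> B by [].
congr (0 <= _); ring.
Qed.

Lemma ucp_psd phi (e : B) x : ucp_map phi -> psd st e -> 0 <= inner (phi e x) x.
Proof.
move=> uphi pe; have [lphi _ _] := uphi.
have := ucp_block 0 0 x uphi pe.
by rewrite rmorph0 !mulr0 (linear_zeroP lphi) !zero_opE !inner0l !addr0.
Qed.

(** In ucp_block, replacing y by l y with |l| = 1 multiplies the cross terms by
l and its conjugate. The values l = 1 and l = i show that the cross terms are
conjugate to each other; then l is chosen to make both of them equal to minus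
their modulus. *)
Lemma ucp_cauchy_schwarz phi (e g : B) x y : ucp_map phi -> psd st e ->
  `|inner (phi (e * g) x) y| *+ 2 <=
  inner (phi e y) y + inner (phi (e * (st g * g)) x) x.
Proof.
move=> uphi pe; set p := inner (phi e y) y; set q := inner _ x.
have p0 : 0 <= p by exact: ucp_psd.
have q0 : 0 <= q by apply: ucp_psd => //; exact: psdM (psd_sq _ _).
set z := inner _ y.
have block l : `|l| = 1 -> 0 <= p + q + (l^* * z + l * inner (phi (e * st g) y) x).
  move=> l1; have := ucp_block g x (l *: y) uphi pe.
  rewrite !opZ !innerZl !innerZr -/p -/q -/z.
  have -> : l * (l^* * p) = p by rewrite mulrA -normCK l1 expr1n mul1r.
  by congr (0 <= _); ring.
have pqr : p + q \is Num.real by rewrite ger0_real ?addr_ge0.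
have real l : `|l| = 1 -> l^* * z + l * inner (phi (e * st g) y) x \is Num.real.
  by move=> /block /ger0_real; rewrite rpredDl.
have zw : z = (inner (phi (e * st g) y) x)^*.
  apply: conj_of_real_polar.
    by have := real 1 (normr1 _); rewrite rmorph1 !mul1r.
  have := real 'i (normCi _); rewrite conjCi; congr (_ \is Num.real); ring.
have [z0|z0] := eqVneq z 0; first by rewrite z0 normr0 mul0rn addr_ge0.
have nz : `|z| != 0 by rewrite normr_eq0.
pose l := - (z / `|z|).
have l1 : `|l| = 1 by rewrite normrN normf_div normr_id divff.
have := block _ l1.
have -> : l * inner (phi (e * st g) y) x = - `|z|.
  rewrite -[inner _ x]conjCK -zw /l mulNr mulrAC -normCK expr2 mulfK//.
have -> : l^* * z = - `|z|.
  rewrite /l rmorphN fmorph_div/= [(`|z|)^*]conj_Creal ?normr_real// mulNr mulrAC.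
  by rewrite [_^* * z]mulrC -normCK expr2 mulfK.
by rewrite -opprD subr_ge0 mulr2n.
Qed.

Notation is_character := (@character R B k st).

Definition character_map (chi : B -> R[i]) : A -> BH := fun a => chi a *: (1 : BH).

Lemma adjoint1 : adjoint (1 : BH) = 1.
Proof. exact: adjoint_unique. Qed.

Lemma adjoint_adjoint_inner (T : BH) x y : inner (adjoint T x) y = inner x (T y).
Proof. by rewrite inner_conj -adjointP -inner_conj. Qed.

Lemma characterZ chi c a : is_character chi -> chi (c *: (a : A) : A) = c * chi a.
Proof.
by move=> [_ chiM chiK _]; rewrite -[c *: _]/(c *: (a : A)) -(scalar_mul c a) chiM chiK.
Qed.

Lemma character_map_hom chi : is_character chi -> unital_star_hom (character_map chi).
Proof.
move=> cchi; have [chiD chiM chiK chiJ] := cchi; split.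
- move=> c a b; rewrite /character_map chiD characterZ//.
  by rewrite scalerDl scalerA.
- by rewrite /character_map -(rmorph1 k) chiK scale1r.
- move=> a b; rewrite /character_map [chi _]chiM; apply: bounded_op_ext => x.
  by rewrite mul_opE !scale_opE !one_opE scalerA.
- move=> a; rewrite /character_map [chi _]chiJ; apply/esym/adjoint_unique => x y.
  by rewrite !scale_opE !one_opE innerZl innerZr conjCK.
Qed.

(** The quadratic form of such a map at the hermitian square of Y is a sum of squared
norms: sum chi_l(Y p j) T_l x_j over j for each l and p. *)
Lemma character_comb_ucp n (T : 'I_n -> BH) (chi : 'I_n -> B -> R[i]) phi :
  (forall i, is_character (chi i)) ->
  cstar_convex_comb T (fun i => character_map (chi i)) phi -> ucp_map phi.
Proof.
move=> cchi [T1 phiE]; split.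
- move=> c a b; rewrite !phiE scaler_sumr -big_split/=; apply: eq_bigr => i _.
  have [lin _ _ _] := character_map_hom (cchi i).
  apply: bounded_op_ext => x; rewrite lin.
  by rewrite add_opE scale_opE !mul_opE add_opE scale_opE opD opZ.
- rewrite phiE -[RHS]T1; apply: eq_bigr => i _.
  by have [_ -> _ _] := character_map_hom (cchi i); rewrite mulr1.
move=> m X [Y ->] x.
pose v i p := \sum_j chi i (Y p j) *: T i (x j).
suff -> : \sum_i \sum_j inner (map_mx phi ((map_mx star Y)^T *m Y) i j (x j)) (x i) =
    \sum_i \sum_p inner (v i p) (v i p).
  by apply: sumr_ge0 => i _; apply: sumr_ge0 => p _; exact: inner_ge0.
pose F l p i j := chi l (Y p j) * ((chi l (Y p i))^* * inner (T l (x j)) (T l (x i))).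
transitivity (\sum_i \sum_j \sum_l \sum_p F l p i j).
  apply: eq_bigr => i _; apply: eq_bigr => j _; rewrite !mxE phiE sum_opE inner_suml.
  apply: eq_bigr => l _; have [chiD chiM chiK chiJ] := cchi l.
  rewrite !mul_opE /character_map scale_opE one_opE adjoint_adjoint_inner innerZl.
  have chi0 : chi l 0 = 0 by rewrite -(rmorph0 k) chiK.
  rewrite (big_morph (chi l) chiD chi0) mulr_suml; apply: eq_bigr => p _.
  by rewrite !mxE [chi l _]chiM [chi l (star _)]chiJ /F; ring.
transitivity (\sum_l \sum_p \sum_i \sum_j F l p i j).
  under eq_bigr => i _ do rewrite exchange_big/=.
  rewrite exchange_big/=; apply: eq_bigr => l _.
  under eq_bigr => i _ do rewrite exchange_big/=.
  by rewrite exchange_big.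
apply: eq_bigr => l _; apply: eq_bigr => p _; rewrite exchange_big/= inner_suml.
apply: eq_bigr => j _; rewrite inner_sumr; apply: eq_bigr => i _.
by rewrite innerZl innerZr.
Qed.

Lemma character_map_ucp chi : is_character chi -> ucp_map (character_map chi).
Proof.
move=> cchi; apply: (@character_comb_ucp 1 (fun=> 1) (fun=> chi)) => //.
by split=> [|a]; rewrite big_ord_recl big_ord0 addr0 adjoint1 ?mul1r ?mulr1.
Qed.

(** If chi(a) = 0, the nonnegative forms of the psi_j(star(a) a), compressed by T_j,
add up to 0, so each of them vanishes; as T_j is invertible, psi_j(star(a) a) has
zero form. By ucp_cauchy_schwarz psi_j(a) = 0. Hence psi_j and chi 1 agree, and
the unitary is 1. *)
Lemma character_map_extreme chi : is_character chi -> cstar_extreme (character_map chi).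
Proof.
move=> cchi; split; first exact: character_map_ucp.
move=> n T psi psiU Tinv [T1 comb] i.
have [chiD chiM chiK chiJ] := cchi.
have [lpsi psi1 _] := psiU i.
have ker (a : B) : chi a = 0 -> psi i a = 0.
  move=> a0.
  have kerP y : inner (psi i (st a * a) (T i y)) (T i y) = 0.
    have : \sum_j inner (psi j (st a * a) (T j y)) (T j y) = 0.
      have : character_map chi (st a * a) y = 0.
        by rewrite /character_map chiM a0 mulr0 scale0r.
      rewrite comb sum_opE => /(congr1 (inner^~ y)); rewrite inner0l inner_suml => s0.
      rewrite -[RHS]s0; apply: eq_bigr => j _.
      by rewrite !mul_opE adjoint_adjoint_inner.
    move=> /eqP; rewrite psumr_eq0 => [/allP/(_ i)|j _].
      by rewrite mem_index_enum => /(_ isT)/eqP.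
    by apply: ucp_psd => //; exact: psd_sq.
  have {}kerP y : inner (psi i (st a * a) y) y = 0.
    have [S [_ TS]] := Tinv i.
    have TSy : T i (S y) = y by rewrite -mul_opE TS.
    by have := kerP (S y); rewrite TSy.
  apply: bounded_op_ext => x; rewrite zero_opE.
  set y := psi i a x.
  have p1 : psd st (1 : B) by have := psd_sq st 1; rewrite rmorph1 mulr1.
  have := ucp_cauchy_schwarz a x (2^-1 *: y) (psiU i) p1.
  rewrite !mul1r psi1 one_opE kerP addr0 !innerZr innerZl -/y.
  rewrite geC0_conj ?invr_ge0 ?ler0n// normrM [`|inner y y|]ger0_norm ?inner_ge0//.
  have e2 (w : R[i]) : 2^-1 * w *+ 2 = w by field.
  rewrite ger0_norm ?invr_ge0 ?ler0n// e2 mulrA -subr_le0 -[X in X - _]mul1r -mulrBl.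
  have -> : 1 - 2^-1 * 2^-1 = 3 / 4 :> R[i] by field.
  rewrite pmulr_rle0 ?divr_gt0// => y0.
  by apply/inner_eq0/eqP; rewrite eq_le inner_ge0 y0.
exists 1; first by split; rewrite adjoint1 mulr1.
move=> a; rewrite adjoint1 mul1r mulr1.
have -> : psi i a = psi i (a - chi a *: 1) + chi a *: psi i 1.
  by rewrite -linear_scaleP// -linear_addP// subrK.
rewrite psi1 ker ?add0r//.
change (chi (a - k (chi a)) = 0).
by rewrite (characterB _ _ cchi) chiK subrr.
Qed.

(** With a partition of unity e_j of variance at most eta^2, phi(a) - psi(a) is the sum
of the phi(e_j (a - chi_j(a))). By ucp_cauchy_schwarz its matrix coefficient at
x and z is at most <z, z> + eta^2 <x, x>; taking z = eta y gains a factor eta.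
The lower bound c on the e_j is what gives the phi(e_j) a square root. *)
Lemma ucp_approx phi (t : seq A) (eta : R[i]) : ucp_map phi -> 0 < eta ->
  (exists x0 : H, x0 != 0) ->
  exists psi, [/\ ucp_map psi,
    cstar_convex_hull [set character_map chi | chi in is_character] psi
    & forall a, a \in t -> forall x y,
      `|inner (phi a x) y - inner (psi a x) y| <= eta * (inner x x + inner y y)].
Proof.
move=> uphi eta0 [x0 x00]; have [lphi phi1 _] := uphi.
(* The cone of A is proper because phi maps it to positive operators on a nonzero
space. *)
have N1 : ~ psd st (-1).
  move=> /(ucp_psd x0 uphi); have -> : phi (-1 : B) = - 1.
    change (phi (- (1 : A)) = -1).
    by rewrite -sub0r linear_subP// linear_zeroP// phi1 sub0r.
  rewrite opp_opE one_opE -scaleN1r innerZl mulN1r oppr_ge0.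
  by rewrite lt_geF// lt_neqAle inner_ge0 eq_sym dnorm_eq0 x00.
have arch := @cstar_arch R A comA.
have [m [e [chi [c [c01 pe cchi e1 pW]]]]] := partition_of_unity
  (@com_starK _ _ _) (@com_star_scalar _ _ _) arch (t : seq B) (exprn_gt0 2 eta0) N1.
have /andP[c0 c1] := c01.
have phi_k z x : phi (k z : B) x = z *: x.
  have -> : phi (k z : B) = z *: phi 1 by rewrite -linear_scaleP.
  by rewrite phi1.
have phiB (a b : B) : phi (a - b) = phi a - phi b by exact: linear_subP.
have pe0 j : psd st (e j).
  rewrite -[e j](subrK (k c)); apply: psdD => //.
  by apply: (psd_k (@com_star_scalar _ _ _)); exact: ltW.
have /choice[T TP] : forall j, exists T : BH, adjoint T = T /\ T * T = phi (e j).
  move=> j; have [| |T aT TT] := sqrt_op c01 (S := phi (e j)); last by exists T.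
  - move=> x; rewrite -subr_ge0; have := ucp_psd x uphi (pe j).
    by rewrite phiB sub_opE phi_k innerBl innerZl.
  - move=> x; rewrite -subr_ge0.
    have -> : inner x x - inner (phi (e j) x) x = inner (phi (1 - e j) x) x.
      by rewrite phiB phi1 sub_opE innerBl.
    apply: ucp_psd => //; rewrite -e1 (bigD1 j)//= addrAC subrr add0r.
    exact: psd_sum.
pose psi a := \sum_j adjoint (T j) * character_map (chi j) a * T j.
have psiE a : psi a = \sum_j chi j a *: phi (e j).
  apply: eq_bigr => j _; have [-> <-] := TP j; apply: bounded_op_ext => x.
  by rewrite scale_opE !mul_opE scale_opE one_opE opZ.
have T1 : \sum_j adjoint (T j) * T j = 1.
  rewrite -phi1 -[RHS]/(phi (1 : B)) -e1 linear_sumP//; apply: eq_bigr => j _.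
  by have [-> ->] := TP j.
have comb : cstar_convex_comb T (fun j => character_map (chi j)) psi by [].
exists psi; split.
- exact: character_comb_ucp comb.
- exists m, T, (fun j => character_map (chi j)); split=> //; last first.
    by move=> j; exists (chi j).
  rewrite lt0n; apply/eqP => m0; move/eqP: e1; rewrite eq_sym big1 ?oner_eq0// => j.
  by have := leq_trans (ltn_ord j) (eq_leq m0).
move=> a at_ x y.
pose g j : B := (a : B) - k (chi j a).
have diff : phi a - psi a = \sum_j phi (e j * g j : B).
  have -> : phi a = phi (\sum_j e j * a : B) by rewrite -mulr_suml e1 mul1r.
  rewrite psiE linear_sumP// -sumrB; apply: eq_bigr => j _.
  have -> : e j * g j = e j * a - k (chi j a) * e j :> B by rewrite /g; ring.
  by rewrite phiB scalar_mul linear_scaleP.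
have bound z : `|\sum_j inner (phi (e j * g j : B) x) z| <=
    inner z z + eta ^+ 2 * inner x x.
  apply: le_trans (ler_norm_sum _ _ _) _.
  apply: (@le_trans _ _ (\sum_j (inner (phi (e j) z) z +
      inner (phi (e j * (st (g j) * g j) : B) x) x))).
    apply: ler_sum => j _; apply: le_trans (ucp_cauchy_schwarz (g j) x z uphi (pe0 j)).
    by rewrite mulr2n lerDl.
  rewrite big_split/= -inner_suml -sum_opE -linear_sumP//.
  have -> : \sum_j e j = (1 : A) by exact: e1.
  rewrite phi1 one_opE lerD2l -inner_suml -sum_opE -linear_sumP//.
  rewrite -innerZl -phi_k -subr_ge0 -innerBl -sub_opE -phiB.
  apply: ucp_psd => //.
  have -> : k (eta ^+ 2) - \sum_j e j * (st (g j) * g j) =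
    (k (eta ^+ 2) - \sum_j e j * spread k st (t : seq B) (chi j)) +
    \sum_j e j * (spread k st (t : seq B) (chi j) - st (g j) * g j).
    rewrite -[RHS]addrA; congr (_ + _); rewrite -!sumrN -big_split/=.
    have E (u v w : B) : - (u * w) = - (u * v) + u * (v - w) by ring.
    by apply: eq_bigr => j _; exact: E.
  apply: psdD => //; apply: psd_sum => j; apply: psdM => //.
  rewrite /spread (big_rem a)//= addrAC subrr add0r.
  by apply: psd_sum => b; exact: psd_sq.
rewrite -innerBl -sub_opE diff sum_opE inner_suml.
have := bound (eta *: y).
under eq_bigr => j _ do rewrite innerZr.
have etaC : eta^* = eta by rewrite geC0_conj// ltW.
rewrite -mulr_sumr normrM innerZl innerZr etaC gtr0_norm//.
have -> : eta * (eta * inner y y) + eta ^+ 2 * inner x x =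
  eta * (eta * (inner x x + inner y y)) by ring.
by rewrite ler_pM2l.
Qed.

End UCPMaps.

(** * Density in the bounded-weak topology *)

Lemma initial_cvg (S : choiceType) (T : topologicalType) (f : S -> T)
    (F : set_system S) (s : S) : Filter F -> f @ F --> f s ->
  F --> (s : initial_topology f).
Proof.
move=> FF cf Q; rewrite nbhsE => -[_ [[U Uo <-] Us] UQ].
by apply: filterS UQ _; apply: cf; apply: open_nbhs_nbhs.
Qed.

Lemma ptws_cvg (U : choiceType) (V : topologicalType)
    (F : set_system (U -> V)) (f : U -> V) :
  Filter F -> (forall t, (fun g => g t) @ F --> f t) -> F --> (f : {ptws U -> V}).
Proof.
by move=> FF cF; apply/cvg_sup => t; apply: initial_cvg; exact: cF.
Qed.

Section Density.
Variables (R : realType) (A : cstarType R) (H : hilbertType R).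
Notation BH := (bounded_op H).

(** The approximating maps for all (t, eta) generate a filter that converges to phi
pointwise in the weak operator topology, so it meets every neighbourhood of phi. *)
Lemma bw_dense_of_approx (X : set (A -> BH)) :
  (forall phi (t : seq A) (eta : R[i]), ucp_map phi -> 0 < eta ->
    exists psi, [/\ ucp_map psi, X psi & forall a, a \in t -> forall x y,
      `|inner (phi a x) y - inner (psi a x) y| <= eta * (inner x x + inner y y)]) ->
  bw_dense X.
Proof.
move=> approx O [phi Ophi] [U Uo UO].
have uphi : ucp_map (val phi) by exact: set_valP.
pose close (t : seq A) (eta : R[i]) (psi : A -> BH) := forall a, a \in t -> forall x y,
  `|inner (val phi a x) y - inner (psi a x) y| <= eta * (inner x x + inner y y).
pose F : set_system (A -> BH) := [set Q | exists t (eta : R[i]), 0 < eta /\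
  forall psi, ucp_map psi -> X psi -> close t eta psi -> Q psi].
have FF : Filter F.
  split.
  - by exists [::], 1.
  - move=> P Q [t [e [e0 tP]]] [s [d [d0 sQ]]].
    have lem (u v : R[i]) : 0 < u -> 0 < v -> exists w, [/\ 0 < w, w <= u & w <= v].
      move=> u0 v0; exists (u * v / (u + v)); rewrite divr_gt0 ?mulr_gt0 ?addr_gt0//.
      rewrite !ler_pdivrMr ?addr_gt0//; split=> //.
        by rewrite ler_pM2l// lerDr ltW.
      by rewrite mulrC ler_pM2l// lerDl ltW.
    have [w [w0 we wd]] := lem _ _ e0 d0.
    have mono (x y : H) (a b : R[i]) : a <= b ->
        a * (inner x x + inner y y) <= b * (inner x x + inner y y).
      by move=> ab; rewrite ler_wpM2r// addr_ge0 ?inner_ge0.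
    exists (t ++ s), w; split=> // psi upsi Xpsi cpsi; split.
      apply: tP => // a at_ x y; apply: le_trans (mono _ _ _ _ we).
      by apply: cpsi; rewrite mem_cat at_.
    apply: sQ => // a as_ x y; apply: le_trans (mono _ _ _ _ wd).
    by apply: cpsi; rewrite mem_cat as_ orbT.
  - by move=> P Q PQ [t [e [e0 tP]]]; exists t, e; split=> // psi u xp c; apply/PQ/tP.
have cF : F --> (val phi : {ptws A -> wot H}).
  apply: (@ptws_cvg A (wot H) F) => a.
  apply: initial_cvg.
  apply: (@ptws_cvg (H * H)%type R[i]^o) => -[x y] /=.
  apply/cvgrPdist_lt => e e0.
  have n0 : 0 <= inner x x + inner y y by rewrite addr_ge0 ?inner_ge0.
  have n1 : 0 < inner x x + inner y y + 1 by rewrite ltr_wpDl.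
  exists [:: a], (e / (inner x x + inner y y + 1)); split; first exact: divr_gt0.
  move=> psi _ _ /(_ a (mem_head _ _) x y) h /=.
  apply: le_lt_trans h _.
  by rewrite mulrAC ltr_pdivrMr// ltr_pM2l// ltrDl.
have [t [e [e0 tU]]] : F U.
  by apply: cF; apply: open_nbhs_nbhs; split=> //; rewrite -UO in Ophi.
have [psi [upsi Xpsi cpsi]] := approx _ t e uphi e0.
exists (SigSub (mem_set upsi : psi \in @UCP R A H)); split => //.
by rewrite -UO; exact: tU.
Qed.

Hypothesis comA : commutative (@GRing.mul A).

(** If H is zero there may be no character in sight, but then all operators are equal
and phi is a convex combination of itself. *)
Lemma bw_dense_hull (N : set (A -> BH)) :
  (forall chi, @character R (com_ring comA) (com_scalar comA) (com_star comA) chi ->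
    N (character_map H chi)) ->
  ((forall x : H, x = 0) -> forall phi, ucp_map phi -> N phi) ->
  bw_dense (cstar_convex_hull N).
Proof.
move=> Nchi N0; apply: bw_dense_of_approx => phi t eta uphi eta0.
have [H0|/existsNP[x0 /eqP x00]] := pselect (forall x : H, x = 0).
  exists phi; split=> //; last first.
    by move=> a _ x y; rewrite subrr normr0 mulr_ge0 ?addr_ge0 ?inner_ge0// ltW.
  have BH0 (S T : BH) : S = T by apply: bounded_op_ext => x; rewrite [LHS]H0 [RHS]H0.
  by exists 1%N, (fun=> 1), (fun=> phi); split=> // i; exact: N0.
have [psi [upsi [n [T [chi [n0 chiE comb]]]] close]] :=
  ucp_approx comA t uphi eta0 (ex_intro _ x0 x00).
exists psi; split=> //; exists n, T, chi; split=> // i.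
by have [c cc <-] := chiE i; exact: Nchi.
Qed.

End Density.

Theorem theorem7p14 (R : realType) (A : cstarType R) (H : hilbertType R)
  (comA : commutative (@GRing.mul A)) (sepH : separable_space H) :
  bw_dense (cstar_convex_hull (@unital_star_hom R A H)) /\
  bw_dense (cstar_convex_hull (@cstar_extreme R A H)).
Proof.
have BH0 : (forall x : H, x = 0) -> forall S T : bounded_op H, S = T.
  by move=> H0 S T; apply: bounded_op_ext => x; rewrite [LHS]H0 [RHS]H0.
split; apply: (bw_dense_hull (comA := comA)).
- by move=> chi; exact: character_map_hom.
- move=> /BH0 E phi [lphi _ _]; split=> //.
- by move=> chi; exact: character_map_extreme.
- move=> /BH0 E phi uphi; split=> // *.
  by exists 1 => //; split.
Qed.
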